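(* Let $k\ge 2$ be an integer, $q$ a prime power, and $h\in\mathbb{F}_q[x]$ a non-constant polynomial. Let $\ell$ be the largest positive integer such that $h=Cf^{\ell}$ for some $C\in\mathbb{F}_q^*$ and $f\in\mathbb{F}_q[x]$ (and fix such $C$ and $f$). Let $n=\gcd(\ell,q-1)$, let $H$ be the subgroup of $\mathbb{F}_q^*$ of index $n$, let $g$ be a generator of $\mathbb{F}_q^*$, and let $s$ be the unique integer in $\{0,1,\ldots,n-1\}$ such that $C\in g^sH$. Suppose that $A\subset\mathbb{F}_q^*$ is such that $a_1\cdots a_k\ne h(x)$ for all distinct $a_1,\dots,a_k\in A$ and all $x\in\mathbb{F}_q$, and that \[ |A|\ge\frac{m(k,n;s)}{n}\cdot q-O(\sqrt q). \] Then there exists a set $B_0\subset\mathbb{Z}_n$ with $|B_0|=m(k,n;s)$ and $s\notin kB_0$ such that \[ \left|A\ \triangle\ \bigcup_{i\in B_0}g^iH\right|=O(\sqrt q). \] Precisely: for all integers $k\ge2$, $D\ge1$ and every real $K\ge 0$ there is a constant $K'=K'(k,D,K)$ such that the following holds for every prime power $q$ and every $h\in\mathbb{F}_q[x]$ with $\deg h=D$. Let $\ell$ be the largest positive integer such that $h$ is a constant multiple of an $\ell$-th power in $\mathbb{F}_q[x]$, let $h=Cf^{\ell}$ with $C\in\mathbb{F}_q^*$ and $f\in\mathbb{F}_q[x]$, let $n=\gcd(\ell,q-1)$, let $H$ be the subgroup of $\mathbb{F}_q^*$ of index $n$, let $g$ be a generator of $\mathbb{F}_q^*$, and let $s\in\{0,1,\ldots,n-1\}$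 satisfy $C\in g^sH$. If $A\subset\mathbb{F}_q^*$ satisfies $a_1\cdots a_k\ne h(x)$ for all distinct $a_1,\dots,a_k\in A$ and all $x\in\mathbb{F}_q$, and $|A|\ge \frac{m(k,n;s)}{n}q-K\sqrt q$, then there exists $B_0\subset\mathbb{Z}_n$ with $|B_0|=m(k,n;s)$, $s\notin kB_0$ and $\left|A\,\triangle\,\bigcup_{i\in B_0}g^iH\right|\le K'\sqrt q$.
   Context: $\mathbb{F}_q$ is the finite field with $q$ elements, $\mathbb{F}_q^*$ its multiplicative group, and $\mathbb{Z}_n=\mathbb{Z}/n\mathbb{Z}$. $\triangle$ denotes symmetric difference. Since $g^n\in H$, the coset $g^iH$ is well defined for $i\in\mathbb{Z}_n$. For $B\subset\mathbb{Z}_n$, the $k$-fold sumset is $kB=\{b_1+\cdots+b_k: b_i\in B \text{ for } 1\le i\le k\}$ (repetitions allowed). For $s\in\mathbb{Z}_n$, $m(k,n;s)=\max\{|B|: B\subset\mathbb{Z}_n,\ s\notin kB\}$ (the empty set is allowed, with empty sumset). An integer $s$ is viewed as an element of $\mathbb{Z}_n$ via reduction mod $n$. *)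

(* Defs.v *)
From HB Require Import structures.
From mathcomp Require Import all_boot all_order all_algebra all_fingroup.
From mathcomp Require Import all_solvable all_field.
From mathcomp Require Import reals.

Set Implicit Arguments.
Unset Strict Implicit.
Unset Printing Implicit Defensive.

Import GRing.Theory.
Local Open Scope ring_scope.

(* The additive group Z/nZ for n > 0.  The library's 'Z_n is not usable here,
   because n = 1 is allowed and 'Z_1 is Z/2Z. *)
Notation Zmod n := 'I_n.-1.+1.

Definition ksumset (G : finZmodType) (k : nat) (B : {set G}) : {set G} :=
  [set \sum_(i < k) b i | b : {ffun 'I_k -> G} in ffun_on (mem B)].

Definition max_avoid (k n : nat) (s : Zmod n) : nat :=
  \max_(B : {set Zmod n} | s \notin ksumset k B) #|B|.

Definition symdiff (T : finType) (X Y : {set T}) : {set T} :=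
  (X :\: Y) :|: (Y :\: X).

Definition scaled_power (F : finFieldType) (h : {poly F}) (l : nat) : Prop :=
  exists (C : {unit F}) (f : {poly F}), h = val C *: f ^+ l.

Definition largest_exponent (F : finFieldType) (h : {poly F}) (l : nat) : Prop :=
  [/\ (0 < l)%N, scaled_power h l
    & forall l' : nat, (0 < l')%N -> scaled_power h l' -> (l' <= l)%N].

Definition avoids_values (F : finFieldType) (k : nat) (A : {set {unit F}})
    (h : {poly F}) : Prop :=
  forall a : 'I_k -> {unit F}, injective a -> (forall i, a i \in A) ->
  forall x : F, \prod_(i < k) val (a i) != h.[x].

(* The coset g^i H depends only on i mod n when g^n is in H; the exponent used
   is the representative of i in {0, ..., n-1}. *)
Definition coset_union (gT : finGroupType) (n : nat) (g : gT) (H : {set gT})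
    (B : {set Zmod n}) : {set gT} :=
  (\bigcup_(i in B) (g ^+ (nat_of_ord i) *: H)%g)%SET.

(* Main.v *)
Require Import Defs.
From HB Require Import structures.
From mathcomp Require Import all_boot all_order all_algebra all_fingroup.
From mathcomp Require Import all_solvable all_field all_character.
From mathcomp Require Import reals.
From mathcomp Require Import zify ring lra.

Set Implicit Arguments.
Unset Strict Implicit.
Unset Printing Implicit Defensive.

Import Order.TTheory GRing.Theory Num.Theory.
Local Open Scope ring_scope.

(* A product a_1 ... a_k of elements of cosets g^(i_j) H with i_1 + ... + i_k = s
   lies in C H, as do all non-zero values of h. If two of the pieces of A in these
   cosets have more than a constant times sqrt q elements, the orthogonality of the
   multiplicative characters chi of F produces a solution of a_1 ... a_k = h(x): the
   characters trivial on H contribute a main term, and the others are controlled by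
   the bound D sqrt q for the sums of chi (h (x)). Hence the cosets in which A is
   large form a set B_0 with s \notin k B_0, and the lower bound on |A| makes B_0
   maximal and these cosets almost full.

   The character sum bound is Weil's. The constant must not depend on the order of
   chi, so it is obtained over all extensions of degree r at once: Stepanov's method,
   applied with exponent q - 1, bounds the lifted sums S_r by c q^(r/2) with c
   depending on q, while S_r = q^r - sum_w w^r for at most D complex numbers w because
   the L-function of chi is rational. Letting r grow, every frequency above sqrt q
   cancels. *)

(** * Irreducibility of T ^ d - c f *)

(** Maximality of [l] serves one purpose: no prime factor of q - 1 divides all root multiplicities
    of [f], so T^(q-1) - c f is irreducible over the rational functions, and this keeps Stepanov's
    auxiliary polynomial non-zero. The sums are estimated for [f]: chi(h(x)) = chi(C) chi^l(f(x)),
    and chi^l is non-trivial when chi is non-trivial on [H], whose elements are l-th powers. The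
    exponent q - 1 makes Stepanov's method count the fibres of x -> N(f(x)), N being the norm from
    the field with q^r elements to [F]. It gives upper bounds only; lower bounds follow because the
    fibres exhaust the field. The fibre sizes determine the sums of every character at once. The
    loss is a factor polynomial in q, harmless because r grows with q fixed. Distinctness of the
    factors costs a constant: all but two are frozen at distinct elements, and these two range over
    disjoint sets of size m. Parseval for the two sets gives m = O(D sqrt q). Since n <= D, the
    small pieces together stay O(sqrt q). *)

Lemma underdetermined_system (K : fieldType) (I L : finType) (A : I -> L -> K) :
  (#|L| < #|I|)%N ->
  exists2 c : I -> K, (exists i, c i != 0) & forall l, \sum_i c i * A i l = 0.
Proof.
move=> ltLI; pose M := \matrix_(i < #|I|, l < #|L|) A (enum_val i) (enum_val l).
have nzker : kermx M != 0.
  rewrite -mxrank_eq0 mxrank_ker -lt0n subn_gt0.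
  exact: leq_ltn_trans (rank_leq_col M) ltLI.
pose v := nz_row (kermx M).
have [i vi] : exists i, v 0 i != 0.
  have: v != 0 by rewrite nz_row_eq0.
  case/matrix0Pn => a [i vai]; exists i.
  by rewrite (ord1 a) in vai.
exists (fun x => v 0 (enum_rank x)).
  by exists (enum_val i); rewrite enum_valK.
move=> l; have : (v *m M) 0 (enum_rank l) = 0.
  have /sub_kermxP -> : (v <= kermx M)%MS by rewrite nz_row_sub.
  by rewrite mxE.
rewrite mxE (reindex (@enum_rank I)) /=; last exact/onW_bij/enum_rank_bij.
by move=> E; rewrite -[RHS]E; apply: eq_bigr => x _; rewrite mxE !enum_rankK.
Qed.

Lemma fractionP (R : idomainType) (x : {fraction R}) :
  exists n d : R, d != 0 /\ x * FracField.tofrac d = FracField.tofrac n.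
Proof.
elim/quotW: x => x; exists (\n_x), (\d_x); split; first exact: denom_ratioP.
rewrite /FracField.tofrac; unlock.
rewrite -[LHS]/(FracField.mul _ _) -FracField.pi_mul.
apply/eqP; rewrite FracField.equivf_def /FracField.mulf /=.
by rewrite !numden_Ratio ?(mulf_neq0, oner_neq0, denom_ratioP)// !mulr1 mulrC.
Qed.

Lemma det_expr (R : comNzRingType) n (A : 'M[R]_n.+1) d :
  \det (A ^+ d) = \det A ^+ d.
Proof.
elim: d => [|d IHd]; first by rewrite expr0 det1 expr0.
by rewrite exprS det_mulmx IHd exprS.
Qed.

(* If A is the companion matrix of G, then A ^ d = a. *)
Lemma dvd_Xn_sub_const (L : fieldType) (d w : nat) (a : L) (G : {poly L}) :
    G \is monic -> size G = w.+1 -> G %| 'X^d - a%:P ->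
  exists c : L, c ^+ d = a ^+ w.
Proof.
move=> monG; case: w => [|w] sG; first by exists 1; rewrite expr1n expr0.
case/dvdpP => g eqg; have := companionmxK monG.
have eqs : (size G).-1 = w.+1 by rewrite sG.
move: (companionmx G); rewrite eqs => A charA.
exists (\det A); rewrite -det_expr -det_scalar; congr (\det _).
have : horner_mx A ('X^d - a%:P) = 0.
  by rewrite eqg rmorphM /= -charA Cayley_Hamilton mulr0.
by rewrite rmorphB rmorphXn /= horner_mx_X horner_mx_C => /eqP; rewrite subr_eq0 => /eqP.
Qed.

Lemma mup_exp (K : fieldType) (x : K) (p : {poly K}) n :
  p != 0 -> mup x (p ^+ n) = (n * mup x p)%N.
Proof.
move=> p0; elim: n => [|n IHn].
  by rewrite expr0 mul0n mupNroot // -polyC1 rootC oner_neq0.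
by rewrite exprS mupM ?expf_neq0 // IHn mulSn.
Qed.

Lemma mup_scale (K : fieldType) (x c : K) (p : {poly K}) :
  c != 0 -> mup x (c *: p) = mup x p.
Proof. by move=> c0; rewrite -mul_polyC mupMr // rootC. Qed.

(** For d > 0 this says that [d] and all root multiplicities have gcd 1. The form with [w] applies
    directly to the degree of a factor. *)
Definition indecomposable_mod (K : fieldType) (d : nat) (f : {poly K}) :=
  forall w, (forall a : K, d %| w * mup a f)%N -> (d %| w)%N.

Section KummerIrreducible.
Variables (K : fieldType) (f : {poly K}) (c : K) (d : nat).
Hypotheses (f_ind : indecomposable_mod d f) (c0 : c != 0) (f0 : f != 0).
Hypothesis d_gt0 : (0 < d)%N.

Let phi := FracField.tofrac (c *: f).

(** For a factor of degree w some rational function e satisfies e^d = (c f)^w; comparing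
    multiplicities at every point gives d | w, which leaves only the degrees 0 and d. *)
Lemma kummer_factor_degree (G : {poly {fraction {poly K}}}) :
  G %| 'X^d - phi%:P -> (d %| (size G).-1)%N.
Proof.
move=> GP; have P0 : 'X^d - phi%:P != 0.
  by rewrite -size_poly_eq0 size_XnsubC.
have G0 : G != 0 by apply: contraNneq P0 => E; rewrite -dvd0p -E.
have lG0 : lead_coef G != 0 by rewrite lead_coef_eq0.
have [|||e He] := @dvd_Xn_sub_const _ d (size G).-1 phi ((lead_coef G)^-1 *: G).
- by rewrite monicE lead_coefZ mulVf.
- by rewrite size_scale ?invr_eq0 // prednK // lt0n size_poly_eq0.
- by rewrite dvdpZl ?invr_eq0.
have [u [t [t0 eu]]] := fractionP e; apply: f_ind => a.
have E : u ^+ d = (c *: f) ^+ (size G).-1 * t ^+ d.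
  apply/eqP; rewrite -tofrac_eq; apply/eqP.
  by rewrite tofracM !tofracXn -eu exprMn He.
have cf0 : c *: f != 0 by rewrite scaler_eq0 negb_or c0.
have u0 : u != 0.
  have : u ^+ d != 0 by rewrite E mulf_neq0 ?expf_neq0.
  by rewrite expf_eq0 d_gt0.
move/(congr1 (mup a)): E.
rewrite mupM ?expf_neq0 // !mup_exp // mup_scale // => E.
by rewrite -(@dvdn_addl (d * mup a t)) ?dvdn_mulr // -E dvdn_mulr.
Qed.

(** K(X)[T]/(T^d - c f) is a field; this form has no denominators. A common factor of [k] and T^d -
    c f would have positive degree below [d], and without one T^d - c f would divide [V]. *)
Lemma kummer_no_zero_divisor (V k W : {poly {poly K}}) :
    V != 0 -> (size V <= d)%N -> (size k <= d)%N ->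
    V * k = W * ('X^d - (c *: f)%:P) -> k = 0.
Proof.
move=> V0 sV sk E; apply: contraTeq isT => k0.
pose F := @FracField.tofrac {poly K}.
have F_inj : injective F by move=> x y /eqP; rewrite tofrac_eq => /eqP.
pose V' := map_poly F V; pose k' := map_poly F k.
have sV' : size V' = size V by rewrite size_map_inj_poly ?tofrac0.
have sk' : size k' = size k by rewrite size_map_inj_poly ?tofrac0.
have V'0 : V' != 0 by rewrite -size_poly_eq0 sV' size_poly_eq0.
have k'0 : k' != 0 by rewrite -size_poly_eq0 sk' size_poly_eq0.
pose P := 'X^d - phi%:P.
have PVk : P %| V' * k'.
  apply/dvdpP; exists (map_poly F W).
  move/(congr1 (map_poly F)): E; rewrite !rmorphM /= => ->.
  by rewrite rmorphB /= map_polyXn map_polyC.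
have sP : size P = d.+1 by rewrite size_XnsubC.
case: (boolP (coprimep P k')) => [cop|ncop].
  rewrite Gauss_dvdpl // in PVk.
  by have := dvdp_leq V'0 PVk; rewrite sP sV' ltnNge sV.
have := kummer_factor_degree (dvdp_gcdl P k').
have sG := leq_trans (dvdp_leq k'0 (dvdp_gcdr P k')) _.
rewrite sk' in sG; move/sG: sk => {sG}.
move: ncop; rewrite /coprimep.
have : gcdp P k' != 0 by rewrite gcdp_eq0 negb_and k'0 orbT.
rewrite -size_poly_eq0; case: (size _) => [|[|w]] //= _ _ ltwd /dvdn_leq.
by move=> /(_ isT); lia.
Qed.

End KummerIrreducible.

(** * Independence of the powers of f ^ e over low degree coefficients *)

Lemma closed_field_poly_eq0 (K : closedFieldType) (p : {poly K}) :
  (forall x, p.[x] = 0) -> p = 0.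
Proof.
move=> p0; apply/eqP; apply: contraTT isT => pn0.
have /closed_rootP[x] : size (p * 'X + 1) != 1%N.
  have sp_gt0 : (0 < size p)%N by rewrite lt0n size_poly_eq0.
  by rewrite size_polyDl ?size_mulX ?size_poly1 ?ltnS //; lia.
by rewrite rootE !hornerE p0 mul0r add0r oner_eq0.
Qed.

(** Digits in base X^Q do not interact: a constant term of size at most [Q] cannot cancel a non-zero
    multiple of X^Q. *)
Lemma poly_base_Xn_eq0 (K : fieldType) (Q : nat) (P : {poly {poly K}}) :
  (forall j, size (P`_j)%R <= Q)%N -> P.['X^Q] = 0 -> P = 0.
Proof.
elim/poly_ind: P => [//|P c IHP] sP.
rewrite hornerMXaddC => E.
have sc : (size c <= Q)%N.
  by have := sP 0; rewrite coefD coefMX coefC /= add0r.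
have PQ0 : P.['X^Q] = 0.
  apply/eqP; apply: contraT => Pn0; move/eqP: E; rewrite addr_eq0 => /eqP.
  move/(congr1 (size : {poly K} -> nat)).
  rewrite size_mulXn // size_polyN => Es; move: sc.
  by rewrite -Es leqNgt -[X in (X < _)%N]addn0 ltn_add2l lt0n size_poly_eq0 Pn0.
rewrite (IHP _ PQ0) ?mul0r ?add0r; last first.
  by move=> j; have := sP j.+1; rewrite coefD coefMX coefC /= addr0.
by move: E; rewrite PQ0 mul0r add0r => ->; rewrite polyC0.
Qed.

Section CoefficientDegree.
Variable K : fieldType.
Implicit Types P : {poly {poly K}}.

Definition coef_deg_le (w : nat) P := forall j, (size (P`_j)%R <= w.+1)%N.

Lemma coef_deg_leM w1 w2 P1 P2 :
  coef_deg_le w1 P1 -> coef_deg_le w2 P2 -> coef_deg_le (w1 + w2) (P1 * P2).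
Proof.
move=> h1 h2 j; rewrite coefM; apply: (leq_trans (size_sum _ _ _)).
apply/bigmax_leqP => i _; apply: (leq_trans (size_polyMleq _ _)).
by have := h1 i; have := h2 (j - i)%N; lia.
Qed.

Lemma coef_deg_le_sum w (I : finType) (F : I -> {poly {poly K}}) :
  (forall i, coef_deg_le w (F i)) -> coef_deg_le w (\sum_i F i).
Proof.
move=> hF j; rewrite coef_sum; apply: (leq_trans (size_sum _ _ _)).
by apply/bigmax_leqP => i _; apply: hF.
Qed.

Lemma coef_deg_le_det w d (M : 'M[{poly {poly K}}]_d) :
  (forall i j, coef_deg_le w (M i j)) -> coef_deg_le (d * w) (\det M).
Proof.
move=> hM; apply: coef_deg_le_sum => s.
suff H : coef_deg_le (d * w) (\prod_i M i (s i)).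
  move=> j; have := H j; case: (perm.odd_perm s); rewrite ?(expr1, expr0) ?mul1r //.
  by rewrite mulN1r coefN size_polyN.
have -> : (d * w)%N = (\sum_(i < d) w)%N by rewrite sum_nat_const card_ord.
apply: (big_ind2 (fun n P => coef_deg_le n P)) => //.
- by move=> j; rewrite coef1; case: (j == 0)%N; rewrite ?size_poly1 ?size_poly0.
- by move=> n1 P1 n2 P2; apply: coef_deg_leM.
Qed.

End CoefficientDegree.

Section PowerIndependence.
Variables (K : closedFieldType) (f : {poly K}) (d D b e Q : nat).
Hypotheses (d_gt0 : (0 < d)%N) (sf : size f = D.+1) (f_ind : indecomposable_mod d f).
Hypotheses (Qe : Q = (d * e).+1) (bQ : (d * (D + b) < Q)%N).
Hypothesis fQ : f ^+ Q = f \Po 'X^Q.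
Variable k : nat -> {poly {poly K}}.
Hypothesis kb : forall i, coef_deg_le b (k i).
Hypothesis relation : \sum_(i < d) (k i).['X^Q] * f ^+ (e * i) = 0.

(* Row a is the relation multiplied by f ^ (e a + 1), in which f ^ Q is replaced
   by f(Z) and where 'X stands for Z = X ^ Q. *)
Let wrap (a i c : nat) : {poly {poly K}} :=
  if (a + i == c)%N then f%:P else if (a + i == c + d)%N then f^:P else 0.
Let M := \matrix_(a < d, c < d) \sum_(i < d) k i * wrap a i c.

(** [h] stands once for evaluation at Z = X^Q and once for the scaled specialisation at a point. *)
Let sum_wrap (R : comNzRingType) (h : {poly {poly K}} -> R) (y : R) (a i : 'I_d) :
  h 0 = 0 ->
  \sum_(c < d) h (wrap a i c) * y ^+ c =
    if (a + i < d)%N then h f%:P * y ^+ (a + i) else h f^:P * y ^+ (a + i - d).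
Proof.
move=> h0; case: ltnP => hai.
  rewrite (bigD1 (Ordinal hai)) //= big1 ?addr0 /wrap ?eqxx // => c nc.
  rewrite !ifN ?h0 ?mul0r //; first by have := ltn_ord c; lia.
  by apply: contra nc => /eqP E; apply/eqP/val_inj => /=; lia.
have hai' : (a + i - d < d)%N by have := ltn_ord a; have := ltn_ord i; lia.
rewrite (bigD1 (Ordinal hai')) //= big1 ?addr0 /wrap => [|c nc].
  by rewrite subnK // eqxx ifN //; have := ltn_ord i; have := ltn_ord a; lia.
rewrite !ifN ?h0 ?mul0r //; last by have := ltn_ord c; lia.
by apply: contra nc => /eqP E; apply/eqP/val_inj => /=; lia.
Qed.

(** At Z = X^Q the vector of the f^(e c), with entry 1 at c = 0, lies in the kernel. The determinant
    has X-degree at most d (D + b) < Q, so its vanishing at Z = X^Q is formal. *)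
Let detM0 : \det M = 0.
Proof.
apply: (@poly_base_Xn_eq0 _ Q).
  move=> j; apply: leq_trans bQ.
  apply: (@coef_deg_le_det _ (D + b)) => a c; rewrite mxE.
  apply: coef_deg_le_sum => i; rewrite addnC; apply: coef_deg_leM; first exact: kb.
  rewrite /wrap => l; case: ifP => _; last case: ifP => _.
  - by rewrite coefC; case: ifP => _; rewrite ?sf ?size_poly0.
  - by rewrite coef_map; apply: leq_trans (size_polyC_leq1 _) _.
  - by rewrite coef0 size_poly0.
pose h : {rmorphism {poly {poly K}} -> {poly K}} := horner_eval 'X^Q.
have -> : (\det M).['X^Q] = \det (map_mx h M)^T by rewrite det_tr det_map_mx.
apply/eqP/det0P; exists (\row_(i < d) f ^+ (e * i)).
  apply/rV0Pn; exists (Ordinal d_gt0); rewrite mxE muln0 expr0.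
  exact: oner_neq0.
apply/rowP => a; rewrite !mxE.
under eq_bigr => c _ do rewrite !mxE rmorph_sum /= mulr_sumr.
rewrite exchange_big /=.
transitivity (f * f ^+ (e * a) * \sum_(i < d) (k i).['X^Q] * f ^+ (e * i)); last first.
  by rewrite relation mulr0.
rewrite mulr_sumr; apply: eq_bigr => i _.
transitivity ((k i).['X^Q] * \sum_(c < d) h (wrap a i c) * (f ^+ e) ^+ c).
  rewrite mulr_sumr; apply: eq_bigr => c _.
  by rewrite -exprM mulrC /= /horner_eval hornerM mulrA.
rewrite sum_wrap ?rmorph0 // [RHS]mulrCA; congr (_ * _).
have -> : h f%:P = f by rewrite /= /horner_eval hornerC.
have -> : f * f ^+ (e * a) * f ^+ (e * i) = f ^+ (e * (a + i)).+1.
  by rewrite -mulrA -exprD -mulnDr exprS.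
rewrite -[h f^:P]/(f \Po 'X^Q) -fQ -!exprM -exprS -!exprD.
by case: ltnP => hai //; congr (_ ^+ _); rewrite Qe; have := subnK hai; nia.
Qed.

(** At X = x the entry [f%:P] becomes the constant f(x) while [f^:P] stays f(Z), so row a becomes
    f(x) times the coefficients of T^a k(T) reduced modulo T^d - f(Z)/f(x). A kernel vector of this
    singular matrix is a non-zero V with V k = 0 in a field, whence k = 0. *)
Let specialised (x : K) : f.[x] != 0 ->
  forall i, (i < d)%N -> map_poly (horner_eval x) (k i) = 0.
Proof.
move=> fx i ltid; pose sp : {rmorphism {poly {poly K}} -> {poly K}} := map_poly (horner_eval x).
have : \det (map_mx sp M) = 0 by rewrite det_map_mx detM0 rmorph0.
move/eqP/det0P => [v v0 vM].
pose kk := \poly_(i < d) sp (k i).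
suff : kk = 0 by move/(congr1 (fun p : {poly _} => p`_i)); rewrite coef_poly ltid coef0.
have c0 : (f.[x])^-1 != 0 by rewrite invr_eq0.
have f0 : f != 0 by rewrite -size_poly_eq0 sf.
pose W := \sum_(a < d) \sum_(i < d)
  if (a + i < d)%N then 0 else (v 0 a * sp (k i)) *: 'X^(a + i - d).
apply: (@kummer_no_zero_divisor _ f (f.[x])^-1 d f_ind c0 f0 d_gt0 (rVpoly v) _ W).
- by apply: contra v0 => /eqP E; rewrite -[v]rVpolyK E linear0.
- exact: size_poly.
- exact: size_poly.
apply/eqP; rewrite -subr_eq0; apply/eqP.
pose y : {poly {poly K}} := 'X.
pose cf : {poly {poly K}} := ((f.[x])^-1 *: f)%:P.
transitivity (\sum_(c < d) (f.[x]^-1%:P * (v *m map_mx sp M) 0 c) *: y ^+ c); last first.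
  by rewrite vM big1 // => c _; rewrite mxE mulr0 scale0r.
transitivity (\sum_(a < d) \sum_(i < d) (v 0 a * sp (k i))%:P *
   (if (a + i < d)%N then y ^+ (a + i) else cf * y ^+ (a + i - d))).
  have -> : rVpoly v = \sum_(a < d) v 0 a *: y ^+ a.
    rewrite /rVpoly poly_def; apply: eq_bigr => a _.
    by congr (_ *: _); case: insubP => [j _ jE|]; [congr (v _ _); apply: val_inj|rewrite ltn_ord].
  rewrite /kk poly_def mulr_suml /W mulr_suml -sumrB; apply: eq_bigr => a _.
  rewrite mulr_sumr mulr_suml -sumrB; apply: eq_bigr => j _.
  rewrite -scalerAl -scalerAr scalerA -exprD.
  case: ltnP => haj; first by rewrite mul0r subr0 mul_polyC.
  rewrite -scalerAl mulrBr -exprD subnK // scalerBr opprB addrC subrK.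
  by rewrite mul_polyC [cf * _]mulrC.
under [RHS]eq_bigr => c _ do rewrite mxE mulr_sumr scaler_suml.
rewrite [RHS]exchange_big /=; apply: eq_bigr => a _.
pose h (P : {poly {poly K}}) : {poly {poly K}} := ((f.[x])^-1%:P * sp P)%:P.
under [RHS]eq_bigr => c _ do rewrite !mxE rmorph_sum mulr_sumr mulr_sumr scaler_suml.
rewrite [RHS]exchange_big /=; apply: eq_bigr => j _.
transitivity ((v 0 a * sp (k j))%:P * \sum_(c < d) h (wrap a j c) * y ^+ c); last first.
  rewrite mulr_sumr; apply: eq_bigr => c _.
  rewrite -[map_poly _ (_ * _)]/(sp (k j * wrap a j c)) (rmorphM sp) -mul_polyC /h mulrA.
  by rewrite -polyCM; congr (_%:P * _); ring.
congr (_ * _); rewrite sum_wrap /h ?rmorph0 ?mulr0 ?rmorph0 //.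
have -> : sp f%:P = f.[x]%:P by rewrite /= map_polyC.
have -> : sp f^:P = f.
  rewrite /= -map_poly_comp map_poly_id // => z _ /=.
  by rewrite /horner_eval hornerC.
rewrite -polyCM mulVf // mul1r /cf mul_polyC.
by case: ifP.
Qed.

(** The product of f with any coefficient of [k i] vanishes at every point: at the roots of f
    trivially, elsewhere by specialisation. *)
Lemma power_independence i : (i < d)%N -> k i = 0.
Proof.
move=> ltid; apply/polyP => j; rewrite coef0.
have f0 : f != 0 by rewrite -size_poly_eq0 sf.
apply/eqP; rewrite -(mulrI_eq0 _ (mulfI f0)); apply/eqP.
apply: closed_field_poly_eq0 => x; rewrite hornerM.
have [->|fx] := eqVneq f.[x] 0; first by rewrite mul0r.
have := specialised fx ltid => /(congr1 (fun p : {poly _} => p`_j)).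
by rewrite coef_map coef0 /= /horner_eval => ->; rewrite mulr0.
Qed.

End PowerIndependence.

(** * Stepanov's method *)

Lemma dvdp_Xn_coef (K : fieldType) n (p : {poly K}) :
  reflect (forall l, (l < n)%N -> p`_l = 0) ('X^n %| p).
Proof.
apply: (iffP (dvdpP _ _)) => [[q ->] l ltln|p0]; first by rewrite coefMXn ltln.
exists (drop_poly n p); rewrite -[LHS](poly_take_drop n).
suff -> : take_poly n p = 0 by rewrite add0r.
by apply/polyP => l; rewrite coef_take_poly coef0; case: ifP => // /p0.
Qed.

Lemma dvdp_prod_XsubC_exp (K : fieldType) (R : {poly K}) (M : nat) (s : seq K) :
    uniq s -> (forall x, x \in s -> ('X - x%:P) ^+ M %| R) ->
  (\prod_(x <- s) ('X - x%:P)) ^+ M %| R.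
Proof.
elim: s => [|x s IHs] /= => [_ _|/andP[xs us] sR].
  by rewrite big_nil expr1n dvd1p.
rewrite big_cons exprMn Gauss_dvdp.
  rewrite sR ?mem_head //=; apply: IHs => // y ys.
  by apply: sR; rewrite inE ys orbT.
apply/coprimep_expl/coprimep_expr.
by rewrite coprimep_sym coprimep_XsubC root_prod_XsubC.
Qed.

Lemma leq_size_multiple_roots (K : fieldType) (R : {poly K}) (M : nat) (s : seq K) :
    R != 0 -> uniq s -> (forall x, x \in s -> ('X - x%:P) ^+ M %| R) ->
  (M * size s < size R)%N.
Proof.
move=> R0 us /(dvdp_prod_XsubC_exp us); set P := \prod_(x <- s) _ => PR.
apply: leq_trans (dvdp_leq R0 PR).
have Pm : P \is monic by apply: monic_prod => i _; apply: monicXsubC.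
have := size_exp P M.
rewrite size_prod_XsubC /= => E.
have : (0 < size (P ^+ M))%N by rewrite lt0n size_poly_eq0 monic_neq0 ?monic_exp.
by move=> gt0; rewrite -(prednK gt0) ltnS E mulnC.
Qed.

Lemma dvdp_sub_sum (K : fieldType) (I : finType) (p : {poly K}) (A B : I -> {poly K}) :
  (forall i, p %| A i - B i) -> p %| \sum_i A i - \sum_i B i.
Proof.
move=> H; rewrite -sumrB.
by apply: (big_ind (fun q => p %| q)) => [||i _]; [exact: dvdp0|exact: dvdp_add|].
Qed.

Section Weight.
Variables (K : fieldType) (D : nat).
Implicit Types P : {poly {poly K}}.

(** The outer variable T has weight [D], since in x + f(x) T each T brings a factor f(x) of degree
    [D]. *)
Definition weight_le (w : nat) P := forall l, (size (P`_l)%R <= (w + l * D).+1)%N.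

Lemma weight_leM w1 w2 P1 P2 :
  weight_le w1 P1 -> weight_le w2 P2 -> weight_le (w1 + w2) (P1 * P2).
Proof.
move=> h1 h2 j; rewrite coefM; apply: (leq_trans (size_sum _ _ _)).
apply/bigmax_leqP => i _; apply: (leq_trans (size_polyMleq _ _)).
have lij : (i <= j)%N by rewrite -ltnS.
have := leq_add (h1 i) (h2 (j - i)%N).
have -> : (j * D = i * D + (j - i) * D)%N by rewrite -mulnDl subnKC.
by set a := size _; set b := size _; lia.
Qed.

Lemma weight_leD w P1 P2 : weight_le w P1 -> weight_le w P2 -> weight_le w (P1 + P2).
Proof.
move=> h1 h2 j; rewrite coefD; apply: (leq_trans (size_polyD _ _)).
by rewrite geq_max h1 h2.
Qed.

Lemma weight_leC w (p : {poly K}) : (size p <= w.+1)%N -> weight_le w p%:P.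
Proof.
move=> sp l; rewrite coefC; case: eqP => [->|_]; last by rewrite size_poly0.
by rewrite mul0n addn0.
Qed.

Lemma weight_le_exp w P n : weight_le w P -> weight_le (n * w) (P ^+ n).
Proof.
move=> hP; elim: n => [|n IHn]; first by apply: weight_leC; rewrite size_poly1.
by rewrite exprS mulSn; apply: weight_leM.
Qed.

End Weight.

(* Expansions along the line x + f(x) T rather than x + T make every Taylor
   coefficient of f divisible by f, so that no derivative of f ^ (e i) is needed. *)
Section ScaledTaylor.
Variables (K : fieldType) (f : {poly K}) (D : nat).
Hypothesis sf : size f = D.+1.

Definition scaled_shift : {poly {poly K}} := 'X%:P + f%:P * 'X.

Lemma scaled_shift_divisible (P : {poly K}) :
  exists V : {poly {poly K}}, P^:P \Po scaled_shift = P%:P + f%:P * 'X * V.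
Proof.
elim/poly_ind: P => [|P c [V IHP]].
  by exists 0; rewrite rmorph0 comp_poly0 mulr0 addr0.
exists (V * scaled_shift + P%:P).
rewrite rmorphD rmorphM /= map_polyX map_polyC comp_poly_MXaddC IHP.
by rewrite polyCD polyCM /scaled_shift; ring.
Qed.

Lemma weight_scaled_shift : weight_le D 1 scaled_shift.
Proof.
move=> l; rewrite coefD coefC coefCM coefX.
by case: l => [|[|l]]; rewrite ?mulr0 ?mulr1 ?addr0 ?add0r ?size_polyX ?size_poly0 ?sf ?mul1n.
Qed.

Lemma weight_comp_scaled_shift (P : {poly K}) :
  weight_le D (size P).-1 (P^:P \Po scaled_shift).
Proof.
elim/poly_ind: P => [|P c IHP].
  by rewrite rmorph0 comp_poly0 => l; rewrite coef0 size_poly0.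
have [->|P0] := eqVneq P 0.
  by rewrite mul0r add0r map_polyC comp_polyC; apply: weight_leC; apply: leqSpred.
rewrite rmorphD rmorphM /= map_polyX map_polyC comp_poly_MXaddC.
rewrite size_MXaddC (negPf P0) /=.
have sP : (0 < size P)%N by rewrite lt0n size_poly_eq0.
apply: weight_leD.
  by rewrite -(prednK sP) -addn1; apply: weight_leM => //; apply: weight_scaled_shift.
by apply: weight_leC; apply: leq_trans (size_polyC_leq1 _) _.
Qed.

(** Removing the factor f lowers the weight from [D] to 0, so that even a high power of [W] has
    X-degree at most l D in its coefficient of T^l. *)
Lemma scaled_taylor_unit :
  exists2 W : {poly {poly K}}, f^:P \Po scaled_shift = f%:P * W & weight_le D 0 W.
Proof.
have [V EV] := scaled_shift_divisible f.
have f0 : f != 0 by rewrite -size_poly_eq0 sf.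
exists (1 + 'X * V); first by rewrite EV; ring.
move=> l; have := @weight_comp_scaled_shift f l.
have -> : f^:P \Po scaled_shift = f%:P * (1 + 'X * V) by rewrite EV; ring.
set W := _ + _; rewrite coefCM sf.
have [->|Wl] := eqVneq W`_l 0; first by rewrite size_poly0.
by rewrite size_mul // sf; move: (size _) => S /=; lia.
Qed.

Lemma map_comp_scaled_shift (x : K) (P : {poly K}) :
  map_poly (horner_eval x) (P^:P \Po scaled_shift) = P \Po (x%:P + f.[x] *: 'X).
Proof.
rewrite map_comp_poly -map_poly_comp map_poly_id; last first.
  by move=> z _ /=; rewrite /horner_eval hornerC.
congr (_ \Po _); rewrite rmorphD rmorphM /= !map_polyC /= map_polyX /horner_eval hornerX.
by rewrite mul_polyC.
Qed.

(** As f(x) is non-zero, the substitution is undone by (X - x)/f(x), which carries order [M] at 0 to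
    order [M] at x. *)
Lemma dvdp_scaled_shift (x : K) (R : {poly K}) M : f.[x] != 0 ->
  'X^M %| R \Po (x%:P + f.[x] *: 'X) -> ('X - x%:P) ^+ M %| R.
Proof.
move=> fx /dvdpP[q E].
pose u : {poly K} := f.[x]^-1 *: ('X - x%:P).
have : (R \Po (x%:P + f.[x] *: 'X)) \Po u = R.
  rewrite -comp_polyA rmorphD /= comp_polyC comp_polyZ comp_polyX /u scalerA.
  by rewrite mulfV // scale1r addrC subrK comp_polyXr.
rewrite E comp_polyM comp_Xn_poly => <-.
by rewrite exprZn dvdp_mull // dvdpZr ?invr_eq0 ?expf_neq0 // invr_neq0.
Qed.

End ScaledTaylor.

Section Stepanov.
Variables (K : closedFieldType) (f : {poly K}) (d D e Q J M B : nat) (z : K) (s : seq K).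
Hypotheses (d_gt0 : (0 < d)%N) (sf : size f = D.+1) (f_ind : indecomposable_mod d f).
Hypotheses (Qe : Q = (d * e).+1) (eB : e = (D + B)%N) (B_gt0 : (0 < B)%N).
Hypothesis fQ : f ^+ Q = f \Po 'X^Q.
Hypothesis Frob : forall a b : {poly K}, (a + b) ^+ Q = a ^+ Q + b ^+ Q.
Hypotheses (MQ : (M <= Q)%N) (J_gt0 : (0 < J)%N).
Hypothesis unknowns : (M * (B + J + M * D) < d * (J * B))%N.
Hypotheses (us : uniq s) (z0 : z != 0).
Hypothesis sz : forall x, x \in s -> x ^+ Q = x /\ f.[x] ^+ e = z.

Let monomial (i : nat) (jt : nat * nat) := 'X^(jt.2) * f ^+ (e * i) * 'X^(jt.1 * Q).

(** Grouped by i, the sum is a combination of the f^(e i) with factors k_i(X^Q) whose coefficients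
    have degree at most b = B - 1; the choice e = D + B gives d (D + b) < Q. *)
Let sum_monomials_neq0 (c : 'I_d -> 'I_J -> 'I_B -> K) :
  (exists i j t, c i j t != 0) ->
  \sum_i \sum_j \sum_t c i j t *: monomial i (val j, val t) != 0.
Proof.
move=> [i0 [j0 [t0 c0]]]; apply: contra c0 => /eqP E.
pose k (i : nat) : {poly {poly K}} := if insub i is Some i' then
  \poly_(j < J) (if insub j is Some j' then
    \poly_(t < B) (if insub t is Some t' then c i' j' t' else 0) else 0) else 0.
have kb i : coef_deg_le B.-1 (k i).
  move=> j; rewrite /k prednK //; case: insub => [i'|]; last by rewrite coef0 size_poly0.
  rewrite coef_poly; case: ifP => _; last by rewrite size_poly0.
  by case: insub => [j'|]; rewrite ?size_poly0 ?size_poly.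
have bQ : (d * (D + B.-1) < Q)%N.
  by rewrite Qe eB ltnS leq_mul2l leq_add2l leq_pred orbT.
have rel : \sum_(i < d) (k i).['X^Q] * f ^+ (e * i) = 0.
  rewrite -[RHS]E; apply: eq_bigr => i _; rewrite /k valK.
  rewrite poly_def horner_sum mulr_suml; apply: eq_bigr => j _.
  rewrite valK hornerZ hornerXn poly_def !mulr_suml; apply: eq_bigr => t _.
  by rewrite valK /monomial /= -!scalerAl -exprM mulrAC mulnC [(_ * Q)%N]mulnC.
have := power_independence d_gt0 sf f_ind Qe bQ fQ kb rel (ltn_ord i0).
move/(congr1 (fun P : {poly {poly K}} => P`_j0`_t0)).
rewrite /k valK coef_poly ltn_ord valK coef_poly ltn_ord valK !coef0 => ->.
exact: eqxx.
Qed.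

Let size_monomial (i : 'I_d) (j : 'I_J) (t : 'I_B) :
  (size (monomial i (val j, val t)) <= ((J + D) * Q).+1)%N.
Proof.
rewrite /monomial /= size_mulXn; last first.
  by rewrite mulf_neq0 ?expf_neq0 ?polyX_eq0 // -size_poly_eq0 sf.
rewrite mulrC size_mulXn; last by rewrite expf_neq0 // -size_poly_eq0 sf.
have := size_exp f (e * i); rewrite sf /= => E.
set S := size _ in E *; have : (S <= (D * (e * i)).+1)%N by lia.
have hi : (e * i <= e * d.-1)%N by rewrite leq_mul2l; have := ltn_ord i; lia.
have hj : (j * Q <= J.-1 * Q)%N by rewrite leq_mul2r; have := ltn_ord j; lia.
have := ltn_ord t; have := leq_mul (leqnn D) hi.
have : (D * (e * d.-1) + D * e = D * (d * e))%N.
  by rewrite -mulnDr -mulnSr prednK // [(e * d)%N]mulnC.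
have : (J.-1 * Q + Q = J * Q)%N by rewrite -mulSnr prednK.
have : (e <= d * e)%N by rewrite leq_pmull.
rewrite mulnDl {3}Qe mulnS; move: hi hj Qe.
set a1 := (e * d.-1)%N; set a2 := (J.-1 * Q)%N; set a3 := (J * Q)%N.
set a4 := (d * e)%N; set a5 := (D * a4)%N; set a6 := (D * a1)%N; set a7 := (D * _)%N.
set a8 := (e * i)%N; set a9 := (j * Q)%N; set a10 := (D * e)%N.
lia.
Qed.

(** The d J B coefficients of [R] outnumber the M (B + J + M D) linear conditions that force a zero
    of order [M] at all points of [s] at once; the degree of [R] then limits the number of
    points. *)
Lemma stepanov_bound : (M * size s <= (J + D) * Q)%N.
Proof.
have [W fW wW] := scaled_taylor_unit sf.
pose S := (B + J + M * D)%N.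
(* The monomial along x + f(x) T for x in [s], modulo T^Q: f(x)^(e i) has become z^i and x^(j Q) has
   become x^j, so the degree in X no longer grows with [Q]. Vanishing is imposed formally in X,
   hence for all points together. *)
pose E (i : 'I_d) (j : 'I_J) (t : 'I_B) : {poly {poly K}} :=
  (z ^+ i *: 'X^j)%:P * W ^+ (e * i) * scaled_shift f ^+ t.
pose I := ('I_d * ('I_J * 'I_B))%type.
pose A (u : I) (l : 'I_M * 'I_S) : K := (E u.1 u.2.1 u.2.2)`_(l.1)`_(l.2).
have [|c [u0 cu0] cA] := @underdetermined_system K I ('I_M * 'I_S)%type A.
  by rewrite !card_prod !card_ord.
pose R := \sum_i \sum_j \sum_t c (i, (j, t)) *: monomial i (val j, val t).
have R0 : R != 0.
  apply: (@sum_monomials_neq0 (fun i j t => c (i, (j, t)))).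
  by case: u0 cu0 => i [j t] c0; exists i, j, t.
have sR : (size R <= ((J + D) * Q).+1)%N.
  rewrite /R; apply: (leq_trans (size_sum _ _ _)); apply/bigmax_leqP => i _.
  apply: (leq_trans (size_sum _ _ _)); apply/bigmax_leqP => j _.
  apply: (leq_trans (size_sum _ _ _)); apply/bigmax_leqP => t _.
  by apply: leq_trans (size_scale_leq _ _) _; apply: size_monomial.
rewrite -ltnS; apply: leq_trans sR; apply: leq_size_multiple_roots => // x xs.
have [xQ fxz] := sz xs.
have e_gt0 : (0 < e)%N by rewrite eB; lia.
have fx0 : f.[x] != 0.
  by apply: contraNneq z0 => fx0; rewrite -fxz fx0 expr0n eqn0Ngt e_gt0.
apply: (dvdp_scaled_shift fx0).
pose sE : {poly {poly K}} := \sum_i \sum_j \sum_t (c (i, (j, t)))%:P *: E i j t.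
(* In degree [S] and above the coefficient of T^l vanishes by weight, as (J - 1) + (B - 1) + l D <
   S; below, by the choice of [c]. *)
have sE0 l : (l < M)%N -> sE`_l = 0.
  move=> ltlM; apply/polyP => m; rewrite coef0.
  have [ltmS|leSm] := ltnP m S; last first.
    apply: nth_default; apply: leq_trans leSm.
    rewrite /sE !coef_sum; apply: (leq_trans (size_sum _ _ _)); apply/bigmax_leqP => i _.
    rewrite !coef_sum; apply: (leq_trans (size_sum _ _ _)); apply/bigmax_leqP => j _.
    rewrite !coef_sum; apply: (leq_trans (size_sum _ _ _)); apply/bigmax_leqP => t _.
    rewrite coefZ mul_polyC; apply: leq_trans (size_scale_leq _ _) _.
    have wE : weight_le D (J.-1 + (e * i) * 0 + t * 1) (E i j t).
      apply: weight_leM; last exact/weight_le_exp/weight_scaled_shift.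
      apply: weight_leM; last exact: weight_le_exp.
      apply: weight_leC; apply: leq_trans (size_scale_leq _ _) _.
      by rewrite size_polyXn prednK.
    apply: leq_trans (wE l) _; have := ltn_ord t.
    have : (l * D <= M * D)%N by rewrite leq_mul2r (ltnW ltlM) orbT.
    by rewrite /S; move: (l * D)%N (M * D)%N => p1 p2; lia.
  rewrite -[RHS](cA (Ordinal ltlM, Ordinal ltmS)) /sE coef_sum coef_sum.
  rewrite [RHS](eq_bigr (fun u : I => c (u.1, u.2) * A (u.1, u.2) (Ordinal ltlM, Ordinal ltmS)));
    last by case.
  rewrite -(pair_bigA _ (fun i jt => c (i, jt) * A (i, jt) (Ordinal ltlM, Ordinal ltmS))) /=.
  apply: eq_bigr => i _; rewrite !coef_sum.
  rewrite [RHS](eq_bigr (fun u : 'I_J * 'I_B => c (i, (u.1, u.2)) *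
     A (i, (u.1, u.2)) (Ordinal ltlM, Ordinal ltmS))); last by case.
  rewrite -(pair_bigA _ (fun j t => c (i, (j, t)) * A (i, (j, t)) (Ordinal ltlM, Ordinal ltmS))) /=.
  apply: eq_bigr => j _; rewrite !coef_sum; apply: eq_bigr => t _.
  by rewrite coefZ mul_polyC coefZ.
pose h : {poly {poly K}} -> {poly K} := map_poly (horner_eval x).
have XhE : 'X^M %| h sE.
  by apply/dvdp_Xn_coef => l /sE0 El; rewrite /h coef_map El /= rmorph0.
pose v : {poly K} := x%:P + f.[x] *: 'X.
(* Only the powers 'X^(j Q) are not reproduced exactly: along the line they are (x + f(x)^Q 'X^Q)^j,
   congruent to x^j modulo 'X^Q, and M <= Q. *)
suff XRE : 'X^Q %| R \Po v - h sE.
  rewrite -/v -[R \Po v](subrK (h sE)) dvdp_add // (dvdp_trans _ XRE) //.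
  exact: dvdp_exp2l.
rewrite /R /sE /h.
rewrite [X in X - _]raddf_sum [X in _ - X]raddf_sum; apply: dvdp_sub_sum => i.
rewrite [X in X - _]raddf_sum [X in _ - X]raddf_sum; apply: dvdp_sub_sum => j.
rewrite [X in X - _]raddf_sum [X in _ - X]raddf_sum; apply: dvdp_sub_sum => t.
rewrite -[X in _ %| X]/((c (i, (j, t)) *: monomial i (val j, val t)) \Po v -
  h ((c (i, (j, t)))%:P *: E i j t)).
have hv : h (scaled_shift f) = v.
  have -> : scaled_shift f = ('X : {poly K})^:P \Po scaled_shift f.
    by rewrite map_polyX comp_polyX.
  by rewrite /h map_comp_scaled_shift comp_polyX.
have hf : f \Po v = f.[x]%:P * h W.
  by rewrite -map_comp_scaled_shift fW /h rmorphM /= map_polyC.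
set cc := c _.
have -> : h (cc%:P *: E i j t) =
    cc%:P * ((z ^+ i)%:P * (x%:P ^+ j) * h W ^+ (e * i) * v ^+ t).
  rewrite -mul_polyC /h !rmorphM /= !map_polyC /= !rmorphXn /= -/(h _) -/(h _) hv.
  by rewrite /horner_eval hornerC hornerZ hornerXn polyCM !polyC_exp.
have -> : (cc *: monomial i (val j, val t)) \Po v =
    cc%:P * (v ^+ t * ((z ^+ i)%:P * h W ^+ (e * i)) * v ^+ (j * Q)).
  rewrite comp_polyZ -mul_polyC /monomial /= !comp_polyM !comp_Xn_poly rmorphXn /=.
  by rewrite hf exprMn -polyC_exp exprM fxz.
have -> : v ^+ (j * Q) = ('X^Q * (f.[x] ^+ Q)%:P + x%:P) ^+ j.
  rewrite mulnC exprM /v Frob exprZn -polyC_exp xQ; congr (_ ^+ _).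
  by rewrite addrC mulrC mul_polyC.
have -> : forall a b b' w y y' : {poly K},
    a * (y * (b * w) * y') - a * (b * b' * w * y) = (y' - b') * (a * y * b * w).
  by move=> *; ring.
by rewrite subrXX addrK -!mulrA dvdp_mulr.
Qed.

End Stepanov.

(** * Frobenius on an algebraically closed extension *)

Section Frobenius.
Variables (F : finFieldType) (K : closedFieldType) (iota : {rmorphism F -> K}).
Local Notation q := #|F|.

Lemma card_gt1 : (1 < q)%N.
Proof. by rewrite finNzRing_gt1. Qed.

Lemma pchar_nat_card (R : comNzRingType) (h : {rmorphism F -> R}) r :
  [pchar R].-nat (q ^ r)%N.
Proof.
have [p p_pr pF] := finPcharP F.
have /and3P[pq _ _] := fin_ring_pchar_abelem pF.
rewrite pnatX; apply/orP; left.
have : p.-nat q by rewrite -cardsT.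
by apply: sub_in_pnat => p' _ /eqnP ->; apply: rmorph_pchar pF.
Qed.

Lemma frobD r (x y : K) : (x + y) ^+ (q ^ r) = x ^+ (q ^ r) + y ^+ (q ^ r).
Proof. exact/exprDn_pchar/(pchar_nat_card iota). Qed.

Lemma poly_frobD r (x y : {poly K}) :
  (x + y) ^+ (q ^ r) = x ^+ (q ^ r) + y ^+ (q ^ r).
Proof. exact/exprDn_pchar/(pchar_nat_card (polyC \o iota)). Qed.

Lemma frob_gt0 r : (0 < q ^ r)%N.
Proof. by rewrite expn_gt0 (ltn_trans _ card_gt1). Qed.

(** X^q - X already splits over [F], so [K] contains no further root. *)
Lemma frob_fixedP (x : K) : reflect (exists a, x = iota a) (x ^+ q == x).
Proof.
apply: (iffP eqP) => [xq|[a ->]]; last by rewrite -rmorphXn /= expf_card.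
have : root (map_poly iota ('X^q - 'X)) x.
  by rewrite rmorphB /= map_polyXn map_polyX rootE !hornerE xq subrr.
rewrite finField_genPoly rmorph_prod /=.
have -> : \prod_(a : F) map_poly iota ('X - a%:P) =
    \prod_(y <- [seq iota a | a <- enum F]) ('X - y%:P).
  rewrite big_map big_enum /=; apply: eq_bigr => a _.
  by rewrite rmorphB /= map_polyX map_polyC.
by rewrite root_prod_XsubC => /mapP[a _ ->]; exists a.
Qed.

Lemma frob_iter r (x : K) : x ^+ q = x -> x ^+ (q ^ r) = x.
Proof. by move=> xq; elim: r => [|r IHr]; rewrite ?expr1 // expnS exprM xq. Qed.

Lemma frob_poly (f : {poly K}) r : (forall i, f`_i ^+ (q ^ r) = f`_i) ->
  f ^+ (q ^ r) = f \Po 'X^(q ^ r).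
Proof.
elim/poly_ind: f => [|f c IHf] fix_f.
  by rewrite comp_poly0 expr0n eqn0Ngt frob_gt0.
rewrite poly_frobD exprMn comp_poly_MXaddC IHf => [|i].
  congr (_ + _); rewrite -polyC_exp.
  by have := fix_f 0; rewrite coefD coefMX coefC add0r => ->.
by have := fix_f i.+1; rewrite coefD coefMX coefC addr0.
Qed.

(** For r > 0, the subfield with q^r elements. As all these subfields lie in one [K], no extension
    has to be constructed. *)
Definition frob_points (r : nat) : seq K :=
  sval (closed_field_poly_normal ('X^(q ^ r) - 'X : {poly K})).

Section Points.
Variable r : nat.
Hypothesis r_gt0 : (0 < r)%N.

Let q_r_gt1 : (1 < q ^ r)%N.
Proof. by rewrite -(exp1n r) ltn_exp2r ?card_gt1. Qed.

Let size_frob_poly : size ('X^(q ^ r) - 'X : {poly K}) = (q ^ r).+1.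
Proof. by rewrite size_polyDl ?size_polyXn // size_polyN size_polyX. Qed.

Lemma frob_points_prod :
  'X^(q ^ r) - 'X = \prod_(z <- frob_points r) ('X - z%:P) :> {poly K}.
Proof.
rewrite /frob_points; case: closed_field_poly_normal => s /= E.
rewrite {1}E.
suff -> : lead_coef ('X^(q ^ r) - 'X : {poly K}) = 1 by rewrite scale1r.
by rewrite lead_coefDl ?lead_coefXn // size_polyN size_polyX size_polyXn.
Qed.

Lemma mem_frob_points x : (x \in frob_points r) = (x ^+ (q ^ r) == x).
Proof. by rewrite -root_prod_XsubC -frob_points_prod rootE !hornerE subr_eq0. Qed.

Lemma size_frob_points : size (frob_points r) = (q ^ r)%N.
Proof.
have := size_frob_poly; rewrite frob_points_prod.
by rewrite (size_prod_XsubC _ (fun z => z)) => -[].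
Qed.

Lemma uniq_frob_points : uniq (frob_points r).
Proof.
rewrite -separable_prod_XsubC -frob_points_prod unlock.
suff -> : ('X^(q ^ r) - 'X : {poly K})^`() = - 1.
  by rewrite -[X in coprimep _ X]scaleN1r coprimepZr ?coprimep1 // oppr_eq0 oner_neq0.
rewrite derivB derivX derivXn -mulr_natl.
suff -> : (q ^ r)%:R = 0 :> {poly K} by rewrite mul0r sub0r.
have [p p_pr pF] := finPcharP F.
have pK : p \in [pchar {poly K}] by apply: (rmorph_pchar (polyC \o iota)) pF.
apply/eqP; rewrite -(dvdn_pcharf pK).
have := pchar_nat_card (polyC \o iota) r; rewrite (eq_pnat _ (pcharf_eq pK)) => /p_natP[n].
by move=> E; move: q_r_gt1; rewrite E; case: n {E} => // n _; rewrite expnS dvdn_mulr.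
Qed.

End Points.
End Frobenius.

(** * Lifted character sums *)

(** With X = d^2 q (1 + d D) and M = d J - 2 X, the product M B leaves room 2 X B below d J B. The
    rest M J + M^2 D is at most X Q / d because J^2 <= q Q, and Q < 2 d B because Q = d (D + B) + 1
    > 2 + 2 d D. When the subtraction truncates, M = 0 and the claim is trivial. *)
Lemma stepanov_parameters (d D q Q J B e M : nat) :
    (0 < d)%N -> (0 < q)%N -> (0 < J)%N -> (0 < B)%N ->
    Q = (d * e).+1 -> e = (D + B)%N -> (J * J <= q * Q)%N -> (2 + 2 * (d * D) < Q)%N ->
  (M = d * J - 2 * (d * d * q * (1 + d * D)))%N ->
  (M * (B + J + M * D) < d * (J * B))%N.
Proof.
move=> d_gt0 q_gt0 J_gt0 B_gt0 Qe eB JQ Qbig ME.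
pose X := (d * d * q * (1 + d * D))%N.
have X_gt0 : (0 < X)%N by rewrite !muln_gt0 d_gt0 q_gt0.
have [M0|M_gt0] := posnP M; first by rewrite M0 mul0n !muln_gt0 d_gt0 J_gt0.
have dJ : (d * J = M + 2 * X)%N by rewrite ME subnK // ltnW // -subn_gt0 -ME.
suff H : (M * J + M * (M * D) < 2 * X * B)%N.
  by rewrite mulnA dJ !mulnDr mulnDl -addnA ltn_add2l.
have MdJ : (M <= d * J)%N by rewrite dJ leq_addr.
have h1 : (M * J <= d * (q * Q))%N.
  by apply: leq_trans (leq_mul MdJ (leqnn J)) _; rewrite -mulnA leq_mul.
have h2 : (M * (M * D) <= d * d * (q * Q) * D)%N.
  rewrite mulnA leq_mul2r; apply/orP; right.
  by apply: leq_trans (leq_mul MdJ MdJ) _; rewrite mulnACA leq_mul.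
rewrite -(ltn_pmul2l d_gt0).
have h3 : (d * (M * J + M * (M * D)) <= X * Q)%N.
  have -> : (X * Q = d * (d * (q * Q) + d * d * (q * Q) * D))%N by rewrite /X; ring.
  by rewrite leq_mul2l leq_add ?orbT.
apply: leq_ltn_trans h3 _.
have -> : (d * (2 * X * B) = X * (2 * (d * B)))%N by ring.
rewrite ltn_pmul2l //.
move: Qe; rewrite eB mulnDr; move: (d * D)%N (d * B)%N Qbig => a b; lia.
Qed.

Lemma ler_dist_natr (R : numDomainType) (x y c : nat) :
  (x <= y + c)%N -> (y <= x + c)%N -> `|x%:R - y%:R| <= c%:R :> R.
Proof.
move=> xy yx; rewrite real_ler_norml ?rpredB ?realn //; apply/andP; split.
  by rewrite lerBrDr addrC lerBlDr -natrD ler_nat.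
by rewrite lerBlDr -natrD ler_nat addnC.
Qed.

Section CharacterSums.
Variables (F : finFieldType) (K : closedFieldType) (iota : {rmorphism F -> K}).
Local Notation q := #|F|.

(** A left inverse of [iota], so that norms computed in [K] can be fed to a character of [F]. *)
Definition descend (x : K) : F := odflt 0 [pick a | iota a == x].

Lemma descendK : cancel iota descend.
Proof.
move=> a; rewrite /descend; case: pickP => [b /eqP/fmorph_inj //|/(_ a)].
by rewrite eqxx.
Qed.

Lemma descend_fixed x : x ^+ q = x -> iota (descend x) = x.
Proof. by move/eqP/(frob_fixedP iota) => [a ->]; rewrite descendK. Qed.

(** Raising to the power 1 + q + ... + q^(r-1) is the norm to [F] from the field with q^r
    elements. *)
Definition norm_exp (r : nat) := (\sum_(i < r) q ^ i)%N.

Lemma norm_expE r : (q ^ r = (q.-1 * norm_exp r).+1)%N.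
Proof. by rewrite -predn_exp prednK // frob_gt0. Qed.

Lemma norm_exp_fixed r (x : K) : x ^+ (q ^ r) = x ->
  (x ^+ norm_exp r) ^+ q = x ^+ norm_exp r.
Proof.
move=> xQ; have q_gt0 := ltnW (card_gt1 F).
rewrite -exprM mulnC -{1}(prednK q_gt0) mulSn.
case: r xQ => [|r] xQ; first by rewrite /norm_exp big_ord0 muln0.
have e_gt0 : (0 < norm_exp r.+1)%N by rewrite /norm_exp big_ord_recl.
rewrite addnC -(prednK e_gt0) addnS -addSn exprD.
by rewrite prednK // -norm_expE xQ -exprS prednK.
Qed.

(** The last clause is the form in which non-triviality of the character enters. *)
Definition mult_char (psi : F -> algC) :=
  [/\ psi 0 = 0, psi 1 = 1, {morph psi : a b / a * b},
      forall a, a != 0 -> `|psi a| = 1 & \sum_a psi a = 0].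

Variables (f : {poly F}) (D : nat) (psi : F -> algC).
Hypotheses (sf : size f = D.+1) (psiP : mult_char psi).
Local Notation fK := (map_poly iota f).

Definition lifted_char_sum r : algC :=
  \sum_(x <- frob_points F K r) psi (descend (fK.[x] ^+ norm_exp r)).

Let fK_fixed r i : fK`_i ^+ (q ^ r) = fK`_i.
Proof. by apply: frob_iter; rewrite coef_map -rmorphXn /= expf_card. Qed.

Lemma horner_frob r x : fK.[x] ^+ (q ^ r) = fK.[x ^+ (q ^ r)].
Proof.
have := frob_poly iota (fK_fixed r) => /(congr1 (fun p : {poly K} => p.[x])).
by rewrite horner_exp horner_comp hornerXn.
Qed.

Let value r x : F := descend (fK.[x] ^+ norm_exp r).

Lemma iota_value r x : x \in frob_points F K r -> (0 < r)%N ->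
  iota (value r x) = fK.[x] ^+ norm_exp r.
Proof.
move=> xr r_gt0; apply/descend_fixed/norm_exp_fixed; rewrite horner_frob.
by move: xr; rewrite mem_frob_points // => /eqP ->.
Qed.

Let N r a := count (fun x => value r x == a) (frob_points F K r).

Let sum_N r : (0 < r)%N -> (\sum_a N r a = q ^ r)%N.
Proof.
move=> r_gt0; rewrite -(size_frob_points F K r_gt0) -sum1_size.
rewrite (partition_big (value r) predT) //=.
by apply: eq_bigr => a _; rewrite /N -sum1_count.
Qed.

Let N0_le r : (0 < r)%N -> (N r 0%R <= D)%N.
Proof.
move=> r_gt0; rewrite /N -size_filter -ltnS.
have <- : size fK = D.+1 by rewrite size_map_poly.
apply: max_poly_roots.
- by rewrite map_poly_eq0 -size_poly_eq0 sf.
- apply/allP => x; rewrite mem_filter => /andP[/eqP v0 xr].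
  have := iota_value xr r_gt0; rewrite v0 rmorph0 => /esym/eqP.
  by rewrite expf_eq0 => /andP[].
- exact: filter_uniq (uniq_frob_points iota r_gt0).
Qed.

Hypothesis f_ind : indecomposable_mod q.-1 fK.

Let J r := (q ^ uphalf r)%N.
Let delta := (2 * (q.-1 * q.-1 * q * (1 + q.-1 * D)))%N.

(** Stepanov's bound with d = q - 1, Q = q^r and e = [norm_exp r], for which Q = d e + 1 and f(x)^e
    is the norm of f(x). The choice of [J] gives Q <= J^2 <= q Q, and the threshold on r makes q^r
    exceed the constants in the side conditions. *)
Let N_le r a : (2 * (q * D) + 6 < r)%N -> a != 0 ->
  (q.-1 * N r a <= q ^ r + (D + delta) * J r)%N.
Proof.
move=> rbig a0; have q_gt1 := card_gt1 F; have q_gt0 := ltnW q_gt1.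
have r_gt0 : (0 < r)%N by lia.
have d_gt0 : (0 < q.-1)%N by lia.
pose B := (norm_exp r - D)%N.
have qr_big : (2 * (q * D) + 6 < q ^ r)%N.
  by apply: ltn_trans rbig _; apply: ltn_expl.
have d_le_q : (q.-1 <= q)%N by apply: leq_pred.
have Dr : (D < norm_exp r)%N.
  rewrite -(ltn_pmul2l d_gt0); have := norm_expE r.
  have := leq_mul d_le_q (leqnn D).
  by move: (q.-1 * D)%N (q.-1 * norm_exp r)%N (q * D)%N qr_big; lia.
have B_gt0 : (0 < B)%N by rewrite subn_gt0.
have eB : norm_exp r = (D + B)%N by rewrite subnKC // ltnW.
have J_gt0 : (0 < J r)%N by apply: frob_gt0.
have JJ : (J r * J r <= q * q ^ r)%N.
  rewrite /J -expnD -expnS leq_exp2l // addnn; have := odd_double_half r.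
  by rewrite uphalf_half doubleD; case: (odd r); lia.
have QJJ : (q ^ r <= J r * J r)%N.
  rewrite /J -expnD leq_exp2l // addnn; have := odd_double_half r.
  by rewrite uphalf_half doubleD; case: (odd r); lia.
have Qbig : (2 + 2 * (q.-1 * D) < q ^ r)%N.
  have := leq_mul d_le_q (leqnn D).
  by move: (q.-1 * D)%N (q * D)%N qr_big; lia.
pose M := (q.-1 * J r - delta)%N.
have unk := stepanov_parameters d_gt0 q_gt0 J_gt0 B_gt0 (norm_expE r) eB JJ Qbig (erefl M).
pose s := [seq x <- frob_points F K r | value r x == a].
have us : uniq s by exact: filter_uniq (uniq_frob_points iota r_gt0).
have MQ : (M <= q ^ r)%N.
  apply: leq_trans (leq_subr _ _) _; apply: leq_trans (leq_mul d_le_q (leqnn _)) _.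
  rewrite /J -expnS leq_exp2l //; have := odd_double_half r.
  by rewrite uphalf_half; case: (odd r); lia.
have sK : size fK = D.+1 by rewrite size_map_poly.
have ia0 : iota a != 0 by rewrite fmorph_eq0.
have := stepanov_bound d_gt0 sK f_ind (norm_expE r) eB B_gt0
  (frob_poly iota (fK_fixed r)) (poly_frobD iota r) MQ J_gt0 unk us ia0.
have sz x : x \in s -> x ^+ (q ^ r) = x /\ fK.[x] ^+ norm_exp r = iota a.
  rewrite mem_filter => /andP[/eqP <- xr]; rewrite iota_value //; split=> //.
  by move: xr; rewrite mem_frob_points // => /eqP.
move=> /(_ sz); rewrite size_filter -/(N r a).
have NQ : (N r a <= q ^ r)%N by rewrite -(size_frob_points F K r_gt0) count_size.
(* Multiplication by [J r] replaces a division: in M N <= (J + D) Q the leftover multiples of Q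
   become multiples of J after Q <= J^2. *)
move=> MN; rewrite -(leq_pmul2r J_gt0).
have : (q.-1 * J r <= M + delta)%N by rewrite /M -/delta; lia.
move/(leq_mul (leqnn (N r a))) => H.
have -> : (q.-1 * N r a * J r = N r a * (q.-1 * J r))%N by ring.
apply: leq_trans H _; rewrite mulnDr.
have h1 : (N r a * M <= (J r + D) * q ^ r)%N by rewrite mulnC.
have h2 : (N r a * delta <= q ^ r * delta)%N by rewrite leq_mul2r NQ orbT.
apply: leq_trans (leq_add h1 h2) _.
have -> : ((J r + D) * q ^ r + q ^ r * delta = q ^ r * J r + (D + delta) * q ^ r)%N by ring.
by rewrite [X in (_ <= X)%N]mulnDl leq_add2l -[X in (_ <= X)%N]mulnA leq_mul2l QJJ orbT.
Qed.

Let C := (q.-1 * D + q.-1 * (D + delta))%N.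

(** The lower bound for one fibre is the total q^r minus the upper bounds for the other non-zero
    values and for the at most [D] roots of f. *)
Let N_dist r a : (2 * (q * D) + 6 < r)%N -> a != 0 ->
  `|q.-1%:R * (N r a)%:R - (q ^ r)%:R| <= (C * J r)%:R :> algC.
Proof.
move=> rbig a0; have r_gt0 : (0 < r)%N by lia.
have J_gt0 : (0 < J r)%N by apply: frob_gt0.
have d_gt0 : (0 < q.-1)%N by have := card_gt1 F; lia.
rewrite -natrM; apply: ler_dist_natr.
  apply: leq_trans (N_le rbig a0) _; rewrite leq_add2l leq_mul2r /C.
  by apply/orP; right; rewrite (leq_trans _ (leq_addl _ _)) // leq_pmull.
have := sum_N r_gt0; rewrite (bigD1 0) //= (bigD1 a) //= => E.
have : (\sum_(i | (i != 0%R) && (i != a)) q.-1 * N r i <=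
        \sum_(i : F | (i != 0%R) && (i != a)) (q ^ r + (D + delta) * J r))%N.
  by apply: leq_sum => i /andP[i0 _]; apply: N_le.
rewrite -big_distrr /= sum_nat_const.
have -> : #|[pred i : F | (i != 0) && (i != a)]| = q.-1.-1.
  have := cardC [pred i : F | (i != 0) && (i != a)].
  have -> : #|[predC [pred i : F | (i != 0) && (i != a)]]| = 2%N.
    transitivity #|[set (0 : F); a]|; last by rewrite cards2 eq_sym a0.
    by apply: eq_card => i; rewrite !inE negb_and !negbK.
  by move=> <-; rewrite addn2.
have := N0_le r_gt0; have d1 := prednK d_gt0.
move: (\sum_(i | _) _)%N E => S0 E; move: (N r 0) (N r a) E => n0 na E n0D H.
have H1 : (q.-1 * n0 <= q.-1 * D * J r)%N.
  by rewrite -mulnA leq_mul2l (leq_trans n0D) ?orbT // leq_pmulr.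
have H2 : (q.-1 * n0 + q.-1 * na + q.-1 * S0 = q.-1 * q ^ r)%N.
  by rewrite -E !mulnDr addnA.
have H3 : (q.-1.-1 * (q ^ r + (D + delta) * J r) <=
    q.-1.-1 * q ^ r + q.-1 * (D + delta) * J r)%N.
  by rewrite mulnDr leq_add2l mulnA !leq_mul // leq_pred.
have H4 : (q.-1 * q ^ r = q ^ r + q.-1.-1 * q ^ r)%N by rewrite -{1}d1 mulSn.
rewrite /C mulnDl.
move: (q.-1 * n0)%N (q.-1 * na)%N (q.-1 * S0)%N (q.-1 * q ^ r)%N H H1 H2 H3 H4.
move: (q.-1.-1 * q ^ r)%N (q.-1.-1 * _)%N (q.-1 * D * J r)%N (q.-1 * (D + delta) * J r)%N.
move: (q ^ r)%N; lia.
Qed.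

(** As the values of psi sum to 0, the common main term q^r / (q - 1) of the fibres can be
    subtracted; only the deviations remain. *)
Lemma lifted_char_sum_bound : exists c : nat, forall r, (2 * (q * D) + 6 < r)%N ->
  `|lifted_char_sum r| <= (c * q ^ uphalf r)%:R.
Proof.
exists C => r rbig; rewrite -/(J r); have [psi0 psi1 psiM psiN sum0] := psiP.
have d_gt0 : (0 < q.-1)%N by have := card_gt1 F; lia.
have d0 : (0 < q.-1%:R :> algC) by rewrite ltr0n.
have -> : lifted_char_sum r = \sum_a psi a * (N r a)%:R.
  rewrite /lifted_char_sum (partition_big (value r) predT) //=; apply: eq_bigr => a _.
  rewrite (eq_bigr (fun=> psi a)) => [|x /eqP <- //].
  by rewrite big_const_seq iter_addr_0 mulr_natr.
rewrite -(ler_pM2l d0) -[X in X * `|_|]ger0_norm ?(ltW d0) // -normrM mulr_sumr.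
have -> : \sum_a q.-1%:R * (psi a * (N r a)%:R) =
    \sum_a psi a * (q.-1%:R * (N r a)%:R - (q ^ r)%:R).
  under [RHS]eq_bigr => a _ do rewrite mulrBr mulrCA.
  by rewrite sumrB -mulr_suml sum0 mul0r subr0.
rewrite (bigD1 0) //= psi0 mul0r add0r; apply: le_trans (ler_norm_sum _ _ _) _.
have -> : q.-1%:R * (C * J r)%:R = \sum_(a : F | a != 0) (C * J r)%:R :> algC.
  by rewrite sumr_const mulr_natl; congr (_ *+ _); have := cardC1 (0 : F).
apply: ler_sum => a a0; rewrite normrM psiN // mul1r.
exact: N_dist.
Qed.

End CharacterSums.

(** * Frobenius orbits of roots *)

Lemma sum_dvdn_succ (d n : nat) : (0 < d)%N -> (\sum_(i < n * d) (d %| i.+1) = n)%N.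
Proof.
move=> d_gt0; elim: n => [|n IHn]; first by rewrite big_ord0.
rewrite mulSn addnC big_split_ord /= IHn; case: d d_gt0 {IHn} => // d _.
rewrite big_ord_recr /= big1 ?add0n => [|i _].
  by rewrite -addnS dvdn_addr ?dvdn_mull // dvdnn addn1.
by rewrite -addnS dvdn_addr ?dvdn_mull // gtnNdvd // ltnS ltn_ord.
Qed.

Section Orbits.
Variables (F : finFieldType) (K : closedFieldType) (iota : {rmorphism F -> K}).
Local Notation q := #|F|.

(** The embedding is an argument because it makes the power map additive: it gives [K] the
    characteristic of [F]. *)
Definition frob of {rmorphism F -> K} := fun x : K => x ^+ #|F|.

Fact frob_is_zmod_morphism : zmod_morphism (frob iota).
Proof.
have D x y : frob iota (x + y) = frob iota x + frob iota y.
  by have := frobD iota 1 x y; rewrite expn1.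
by move=> x y; rewrite -[X in _ = frob _ X - _](subrK y x) [X in _ = X - _]D addrK.
Qed.

Fact frob_is_monoid_morphism : monoid_morphism (frob iota).
Proof. by split=> [|x y]; rewrite /frob ?expr1n ?exprMn. Qed.

HB.instance Definition _ := GRing.isZmodMorphism.Build K K (frob iota) frob_is_zmod_morphism.
HB.instance Definition _ := GRing.isMonoidMorphism.Build K K (frob iota) frob_is_monoid_morphism.

Local Notation phi := (frob iota).

Lemma iter_frob n x : iter n phi x = x ^+ (q ^ n).
Proof. by elim: n => [|n IHn] /=; rewrite ?expr1 // IHn /frob expnSr exprM. Qed.

(** For x in the field with q^r elements, the characteristic polynomial of x over [F], a power of
    its minimal polynomial. *)
Definition orbit_poly r (x : K) : {poly K} := \prod_(i < r) ('X - (iter i phi x)%:P).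

Lemma size_orbit_poly r x : size (orbit_poly r x) = r.+1.
Proof.
by rewrite /orbit_poly size_prod_XsubC /index_enum -enumT size_enum_ord.
Qed.

Lemma monic_orbit_poly r x : orbit_poly r x \is monic.
Proof. by apply: monic_prod => i _; apply: monicXsubC. Qed.

Lemma map_frob_map_iota (g : {poly F}) : map_poly phi (map_poly iota g) = map_poly iota g.
Proof. by rewrite -map_poly_comp; apply: eq_map_poly => a /=; rewrite /frob -rmorphXn /= expf_card. Qed.

Lemma map_poly_descendK (G : {poly K}) :
  map_poly phi G = G -> map_poly iota (map_poly (descend iota) G) = G.
Proof.
move=> fixG; apply/polyP => i; rewrite coef_map coef_map_id0; last first.
  by rewrite -[0 in LHS](rmorph0 iota) descendK.
by apply: descend_fixed; rewrite -[in RHS]fixG coef_map.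
Qed.

Lemma frob_orbit_poly r x : iter r phi x = x -> map_poly phi (orbit_poly r x) = orbit_poly r x.
Proof.
case: r => [|r] xr; first by rewrite /orbit_poly big_ord0 rmorph1.
rewrite /orbit_poly rmorph_prod /= big_ord_recr [RHS]big_ord_recl /= mulrC.
rewrite rmorphB /= map_polyX map_polyC /= -[phi _]/(iter r.+1 phi x) xr; congr (_ * _).
apply: eq_bigr => i _.
by rewrite rmorphB /= map_polyX map_polyC.
Qed.

Section OneOrbit.
Variables (g : {poly F}) (x : K) (m : nat).
Local Notation gK := (map_poly iota g).
Hypotheses (g0 : g != 0) (sg : size g = m.+1) (gx : root gK x).

Let gK0 : gK != 0. Proof. by rewrite map_poly_eq0. Qed.

Let frob_dvd n y : ('X - y%:P) ^+ n %| gK -> ('X - (phi y)%:P) ^+ n %| gK.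
Proof.
case/dvdpP => h E; rewrite -[X in _ %| X]map_frob_map_iota E rmorphM /= dvdp_mull //.
rewrite (rmorphXn (map_poly phi)) /=.
by rewrite (rmorphB (map_poly phi)) /= map_polyX map_polyC.
Qed.

Let iter_dvd n i : ('X - x%:P) ^+ n %| gK -> ('X - (iter i phi x)%:P) ^+ n %| gK.
Proof. by move=> H; elim: i => //= i; apply: frob_dvd. Qed.

Let iter_cancel i j : iter (i + j) phi x = iter i phi x -> iter j phi x = x.
Proof.
by rewrite iterD; elim: i => //= i IHi E; apply: IHi; apply: fmorph_inj E.
Qed.

(** The iterates stay among the at most [m] roots of g, so two of them coincide, and injectivity of
    Frobenius brings the coincidence back to x. *)
Let orbit_finite : exists n, (0 < n)%N && (iter n phi x == x).
Proof.
pose s := mkseq (fun i => iter i phi x) m.+1.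
have [us|/(uniqPn 0) [i [j [ltij]]]] := boolP (uniq s).
  have : all (root gK) s.
    apply/allP => y /mapP[i _ ->]; have := @iter_dvd 1 i.
    by rewrite !expr1 !dvdp_XsubCl; apply.
  by move/(max_poly_roots gK0)/(_ us); rewrite size_mkseq size_map_poly sg ltnn.
rewrite size_mkseq => ltj; rewrite !nth_mkseq // ?(ltn_trans ltij) // => E.
exists (j - i)%N; rewrite subn_gt0 ltij /=; apply/eqP.
by apply: (@iter_cancel i); rewrite subnKC ?E // ltnW.
Qed.

Let delta := ex_minn orbit_finite.

Let delta_gt0 : (0 < delta)%N.
Proof. by rewrite /delta; case: ex_minnP => n /andP[]. Qed.

Let iter_mul_delta j : iter (j * delta) phi x = x.
Proof.
elim: j => // j IHj; rewrite mulSn iterD IHj /delta.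
by case: ex_minnP => n /andP[_ /eqP].
Qed.

Let iter_fixed n : (iter n phi x == x) = (delta %| n)%N.
Proof.
apply/eqP/idP => [|/dvdnP[j ->]]; last exact: iter_mul_delta.
rewrite {1}(divn_eq n delta) addnC iterD iter_mul_delta => E.
rewrite /dvdn; have : (n %% delta < delta)%N by rewrite ltn_mod.
move: E; rewrite /delta; case: ex_minnP => d _ dmin; case: (n %% d)%N => // b E.
by have := dmin b.+1; rewrite E eqxx => /(_ isT); rewrite ltnNge => ->.
Qed.

Let orbit_poly_mul j : orbit_poly (j * delta) x = orbit_poly delta x ^+ j.
Proof.
elim: j => [|j IHj]; first by rewrite mul0n /orbit_poly big_ord0.
rewrite mulSn addnC exprSr /orbit_poly big_split_ord /= -/(orbit_poly _ x) IHj.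
by congr (_ * _); apply: eq_bigr => i _; rewrite addnC iterD iter_mul_delta.
Qed.

Let orbit_poly_dvd j : (orbit_poly delta x ^+ j %| gK) = (j <= mup x gK)%N.
Proof.
rewrite mup_geq //; apply/idP/idP => [|Xj].
  apply/dvdp_trans/dvdp_exp2r; rewrite /orbit_poly -(prednK delta_gt0).
  by rewrite big_ord_recl /= dvdp_mulr.
have -> : orbit_poly delta x = \prod_(y <- mkseq (fun i => iter i phi x) delta) ('X - y%:P).
  rewrite big_map /orbit_poly -(big_mkord xpredT (fun i => 'X - (iter i phi x)%:P)).
  by rewrite /index_iota subn0.
apply: dvdp_prod_XsubC_exp => [|y /mapP[i _ ->]]; last exact: iter_dvd.
apply/negPn/negP => /(uniqPn 0) [i [k [ltik]]].
rewrite size_mkseq => ltk; rewrite !nth_mkseq // ?(ltn_trans ltik) // => E.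
have : iter (k - i) phi x == x.
  by apply/eqP/(@iter_cancel i); rewrite subnKC ?E // ltnW.
rewrite iter_fixed gtnNdvd ?subn_gt0 //.
by apply: leq_ltn_trans ltk; apply: leq_subr.
Qed.

(** Only multiples j [delta] of the orbit length count. There the orbit polynomial is the j-th power
    of the shortest one, and it divides g exactly when j is at most the multiplicity of x. *)
Lemma orbit_count :
  (\sum_(i < m) ((iter i.+1 phi x == x) && (orbit_poly i.+1 x %| gK)%R) = mup x gK)%N.
Proof.
pose mu := mup x gK.
have le_mu_m : (mu * delta <= m)%N.
  have : orbit_poly (mu * delta) x %| gK by rewrite orbit_poly_mul orbit_poly_dvd.
  move/(dvdp_leq gK0); rewrite size_map_poly sg size_orbit_poly.
  by rewrite ltnS.
rewrite -/mu -[RHS](sum_dvdn_succ mu delta_gt0).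
rewrite -(subnKC le_mu_m) big_split_ord /= [X in (_ + X)%N]big1 ?addn0.
  apply: eq_bigr => i _; rewrite -iterS iter_fixed; case: (boolP (_ %| _)%N) => // /dvdnP[j E].
  rewrite E orbit_poly_mul orbit_poly_dvd /= -/mu.
  by rewrite -(leq_pmul2r delta_gt0) -E ltn_ord.
move=> i _; rewrite -iterS iter_fixed; case: (boolP (_ %| _)%N) => // /dvdnP[j E].
rewrite E orbit_poly_mul orbit_poly_dvd /= -/mu.
by rewrite -(leq_pmul2r delta_gt0) -E leqNgt ltnS leq_addr.
Qed.

End OneOrbit.

Lemma orbit_poly_root r x : (0 < r)%N -> root (orbit_poly r x) x.
Proof. by case: r => // r _; rewrite /orbit_poly big_ord_recl rootM root_XsubC eqxx. Qed.

(** The multiplicities of the roots add up to the degree. This plays the part of the logarithmic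
    derivative of the Euler product, with no factorisation of g over [F]. *)
Lemma count_orbit_divisors (g : {poly F}) m : g \is monic -> size g = m.+1 ->
  (\sum_(i < m) count (fun x => orbit_poly i.+1 x %| map_poly iota g)%R
     (frob_points F K i.+1) = m)%N.
Proof.
move=> mg sg; set gK := map_poly iota g.
have g0 := monic_neq0 mg.
have [rs E] := closed_field_poly_normal gK.
have mgK : gK \is monic by rewrite map_monic.
rewrite (monicP mgK) scale1r in E.
have srs : size rs = m.
  have : size gK = m.+1 by rewrite size_map_poly.
  by rewrite E (size_prod_XsubC _ (fun z => z)) => -[].
transitivity (\sum_(x <- undup rs) \sum_(i < m)
    ((iter i.+1 phi x == x) && (orbit_poly i.+1 x %| gK)%R))%N.
  rewrite exchange_big /=; apply: eq_bigr => i _.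
  transitivity (count (fun x => (iter i.+1 phi x == x) && (orbit_poly i.+1 x %| gK))
      (undup rs)); last by rewrite -sum1_count big_mkcond.
  rewrite -!size_filter; apply: perm_size; apply: uniq_perm.
  - exact/filter_uniq/(uniq_frob_points iota).
  - exact/filter_uniq/undup_uniq.
  move=> x; rewrite !mem_filter mem_undup mem_frob_points // iter_frob.
  case: (boolP (_ %| _)) => [Pg|]; rewrite ?andbF // ?andbT /=.
  have : root gK x.
    rewrite -dvdp_XsubCl (dvdp_trans _ Pg) // dvdp_XsubCl.
    exact: orbit_poly_root.
  by rewrite {1}E root_prod_XsubC => ->; rewrite andbT.
rewrite -[RHS]srs -[RHS]sum1_size -[RHS](big_undup_iterop_count _ rs xpredT) /=.
rewrite [LHS]big_seq [RHS]big_seq; apply: eq_bigr => x; rewrite mem_undup => xrs.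
have gx : root gK x by rewrite E root_prod_XsubC.
apply: etrans (orbit_count g0 sg gx) _; rewrite -/gK E mu_prod_XsubC.
by case: (count_mem x rs) => //= n; elim: n => //= n ->.
Qed.

End Orbits.

(** * The L-function of a character *)

Section MonicPolynomials.
Variable F : fieldType.

(** Over a finite field row vectors form a finite type, which turns sums over monic polynomials of
    degree [m] into indexed sums. *)
Definition monic_of m (v : 'rV[F]_m) : {poly F} := 'X^m + rVpoly v.
Definition monic_coefs m (g : {poly F}) : 'rV[F]_m := poly_rV (g - 'X^m).

Lemma size_monic_of m (v : 'rV[F]_m) : size (monic_of v) = m.+1.
Proof. by rewrite size_polyDl size_polyXn // ltnS size_poly. Qed.

Lemma monic_of_monic m (v : 'rV[F]_m) : monic_of v \is monic.
Proof.
rewrite monicE lead_coefDl ?lead_coefXn //.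
by rewrite size_polyXn ltnS size_poly.
Qed.

Lemma monic_ofK m : cancel (@monic_of m) (@monic_coefs m).
Proof. by move=> v; rewrite /monic_coefs addrC addKr rVpolyK. Qed.

Lemma monic_coefsK m g : g \is monic -> size g = m.+1 -> monic_of (monic_coefs m g) = g.
Proof.
move=> mg sg; rewrite /monic_of poly_rV_K ?subrKC //.
apply/leq_sizeP => j lemj; rewrite coefB coefXn; case: eqP => [->|/eqP nj].
  by move/monicP: mg; rewrite lead_coefE sg /= => ->; rewrite subrr.
by rewrite nth_default ?subr0 // sg ltn_neqAle eq_sym nj.
Qed.

End MonicPolynomials.

Section MonicSums.
Variables (F : finFieldType) (R : nmodType) (phi : {poly F} -> R).

Lemma sum_monic_multiples m r (P : {poly F}) :
    P \is monic -> size P = r.+1 -> (r <= m)%N ->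
  \sum_(v : 'rV[F]_m | P %| monic_of v) phi (monic_of v) =
  \sum_(u : 'rV[F]_(m - r)) phi (P * monic_of u).
Proof.
move=> mP sP lerm; have P0 := monic_neq0 mP.
pose h (u : 'rV[F]_(m - r)) := monic_coefs m (P * monic_of u).
pose h' (v : 'rV[F]_m) := monic_coefs (m - r) (monic_of v %/ P).
have hE u : monic_of (h u) = P * monic_of u.
  apply: monic_coefsK; first by rewrite monicMr ?monic_of_monic.
  by rewrite size_mul ?monic_neq0 ?monic_of_monic // sP size_monic_of /= addnS subnKC.
rewrite (reindex_onto h h') => [|v /dvdpP [g E]]; last first.
  apply: (can_inj (@monic_ofK _ _)); rewrite hE /h' E mulpK // mulrC.
  have mg : g \is monic by have := monic_of_monic v; rewrite E monicMr.
  rewrite monic_coefsK //; apply/eqP; rewrite -(eqn_add2r r) addSn subnK //.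
  have := size_monic_of v; rewrite E size_mul ?monic_neq0 // sP addnS /= => Es.
  by rewrite -Es.
apply: eq_big => u; last by rewrite hE.
by rewrite hE dvdp_mulIl /h' hE mulKp // monic_ofK eqxx.
Qed.

Lemma sum_monic_div D m (f : {poly F}) : f \is monic -> size f = D.+1 ->
  \sum_(v : 'rV[F]_(D + m)) phi (monic_of v) =
  \sum_(u : 'rV[F]_m) \sum_(w : 'rV[F]_D) phi (monic_of u * f + rVpoly w).
Proof.
move=> mf sf; have f0 := monic_neq0 mf.
rewrite pair_bigA /=.
pose h (p : 'rV[F]_m * 'rV[F]_D) := monic_coefs (D + m) (monic_of p.1 * f + rVpoly p.2).
pose h' (v : 'rV[F]_(D + m)) : 'rV[F]_m * 'rV[F]_D :=
  (monic_coefs m (monic_of v %/ f), poly_rV (monic_of v %% f)).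
have sw (w : 'rV[F]_D) : (size (rVpoly w) < size f)%N by rewrite sf ltnS size_poly.
have smf (u : 'rV[F]_m) : size (monic_of u * f) = (D + m).+1.
  by rewrite size_mul ?monic_neq0 ?monic_of_monic // sf size_monic_of /= addnS addnC.
have lt_wf (u : 'rV[F]_m) (w : 'rV[F]_D) : (size (rVpoly w) < size (monic_of u * f)%R)%N.
  by apply: leq_trans (sw w) _; rewrite smf sf ltnS leq_addr.
have hE p : monic_of (h p) = monic_of p.1 * f + rVpoly p.2.
  apply: monic_coefsK; last by rewrite size_polyDl // smf.
  rewrite monicE lead_coefDl // -monicE monicMr ?monic_of_monic //.
rewrite (reindex_onto h h') => [|v _].
  apply: eq_big => p; last by rewrite hE.
  rewrite /h' hE divpD mulpK // divp_small // addr0 modpD modp_mull add0r modp_small //.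
  by rewrite monic_ofK rVpolyK -surjective_pairing eqxx.
apply: (can_inj (@monic_ofK _ _)); rewrite hE /h' /=.
have sq : size (monic_of v %/ f) = m.+1.
  by rewrite size_divp // size_monic_of sf /= subSn ?leq_addr // addKn.
rewrite poly_rV_K; last by rewrite -ltnS -sf ltn_modp.
rewrite monic_coefsK //; first by rewrite -divp_eq.
have := monic_of_monic v; rewrite {1}(divp_eq (monic_of v) f) !monicE lead_coefDl.
  by rewrite lead_coef_Mmonic.
have q0 : monic_of v %/ f != 0 by rewrite -size_poly_eq0 sq.
rewrite size_mul // sq.
by rewrite addSn /= (leq_trans (ltn_modpN0 _ f0)) // leq_addl.
Qed.

End MonicSums.

Section LFunction.
Variables (F : finFieldType) (K : closedFieldType) (iota : {rmorphism F -> K}).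
Variables (D' : nat) (A : 'M[F]_D'.+1) (psi : F -> algC).
Hypothesis psiP : mult_char psi.
Local Notation q := #|F|.
Local Notation D := D'.+1.

(* With this sign, f(x) = det (A - x). *)
Let f := (-1) ^+ D *: char_poly A.
Let S r := lifted_char_sum iota f psi r.

(** For monic g the determinant is the product of f over the roots of g, a resultant. Written with a
    matrix it is multiplicative in g and lies in [F] by construction. *)
Definition norm_char (g : {poly F}) : algC := psi (\det (horner_mx A g)).
Definition L_coef m := \sum_(v : 'rV[F]_m) norm_char (monic_of v).

Lemma norm_charM g h : norm_char (g * h) = norm_char g * norm_char h.
Proof.
by case: psiP => _ _ psiM _ _; rewrite /norm_char rmorphM /= det_mulmx psiM.
Qed.

Lemma L_coef0 : L_coef 0 = 1.
Proof.
case: psiP => _ psi1 _ _ _.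
rewrite /L_coef (big_pred1 0) => [|v]; last by rewrite /= [v]thinmx0 eqxx.
by rewrite /norm_char /monic_of linear0 addr0 expr0 rmorph1 det1.
Qed.

(** By Cayley-Hamilton [norm_char] depends only on g modulo the characteristic polynomial, and every
    residue is taken q^n times by the monic polynomials of degree D + n. *)
Lemma L_coef_rec m : (D <= m)%N -> L_coef m.+1 = q%:R * L_coef m.
Proof.
move=> leDm; rewrite -(subnKC leDm) -addnS; move: (m - D)%N => {leDm}m.
suff H n : L_coef (D + n) = (q ^ n)%:R * \sum_(w : 'rV[F]_D) norm_char (rVpoly w).
  by rewrite !H expnS natrM mulrA.
have sA : size (char_poly A) = D.+1 by rewrite size_char_poly.
rewrite /L_coef (sum_monic_div norm_char n (char_poly_monic A) sA).
rewrite (eq_bigr (fun=> \sum_(w : 'rV[F]_D) norm_char (rVpoly w))) => [|u _].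
  by rewrite sumr_const card_mx mul1n mulr_natl.
apply: eq_bigr => w _; rewrite /norm_char rmorphD rmorphM /=.
by rewrite Cayley_Hamilton mulr0 add0r.
Qed.

Definition orbit_poly_down r (x : K) : {poly F} :=
  map_poly (descend iota) (orbit_poly iota r x).

Section OrbitPoly.
Variables (r : nat) (x : K).
Hypotheses (r_gt0 : (0 < r)%N) (xr : x \in frob_points F K r).

Let xr' : iter r (frob iota) x = x.
Proof. by apply/eqP; rewrite iter_frob -mem_frob_points. Qed.

Lemma orbit_poly_downK : map_poly iota (orbit_poly_down r x) = orbit_poly iota r x.
Proof. exact/map_poly_descendK/frob_orbit_poly. Qed.

Lemma monic_orbit_poly_down : orbit_poly_down r x \is monic.
Proof. by rewrite -(map_monic iota) orbit_poly_downK monic_orbit_poly. Qed.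

Lemma size_orbit_poly_down : size (orbit_poly_down r x) = r.+1.
Proof. by rewrite -(size_map_poly iota) orbit_poly_downK size_orbit_poly. Qed.

Let det_sub_scalar (y : K) : \det (map_mx iota A - y%:M) = (map_poly iota f).[y].
Proof.
rewrite /f map_polyZ rmorphXn rmorphN1 hornerZ /= map_char_poly.
rewrite /char_poly -horner_evalE -det_map_mx -detZ; congr (\det _).
apply/matrixP => i j; rewrite !mxE /= /horner_eval.
by rewrite !hornerE; case: (_ == _); rewrite ?mulr1n ?mulr0n ?hornerX ?hornerC; ring.
Qed.

(** Each factor contributes det(A - x^(q^i)) = f(x^(q^i)) = f(x)^(q^i), and these multiply to the
    norm of f(x). *)
Lemma norm_char_orbit_poly :
  norm_char (orbit_poly_down r x) =
    psi (descend iota ((map_poly iota f).[x] ^+ norm_exp F r)).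
Proof.
rewrite /norm_char; congr psi; apply: (can_inj (descendK iota)).
rewrite -det_map_mx map_horner_mx orbit_poly_downK.
rewrite /orbit_poly rmorph_prod /=.
have -> : forall n, \det (\prod_(i < n) horner_mx (map_mx iota A)
     ('X - (iter i (frob iota) x)%:P)) = (map_poly iota f).[x] ^+ norm_exp F n.
  elim=> [|n IHn]; first by rewrite big_ord0 det1 /norm_exp big_ord0.
  rewrite big_ord_recr det_mulmx IHn /norm_exp big_ord_recr exprD; congr (_ * _).
  rewrite rmorphB /= horner_mx_X horner_mx_C det_sub_scalar iter_frob.
  by rewrite horner_frob.
by rewrite -(iota_value _ _ xr) // descendK.
Qed.

End OrbitPoly.

(** The factor m is, for each monic g of degree m, the number of pairs (r, x) whose orbit polynomial
    divides g. After exchanging the sums, the divisor splits off by multiplicativity. *)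
Lemma L_coef_log_derivative m :
  m%:R * L_coef m = \sum_(i < m) S i.+1 * L_coef (m - i.+1).
Proof.
have Pdvd i x (g : {poly F}) : (i < m)%N -> x \in frob_points F K i.+1 ->
    (orbit_poly_down i.+1 x %| g) = (orbit_poly iota i.+1 x %| map_poly iota g).
  by move=> _ xi; rewrite -(orbit_poly_downK _ xi) // dvdp_map.
transitivity (\sum_(i < m) \sum_(x <- frob_points F K i.+1)
   \sum_(v : 'rV[F]_m | orbit_poly_down i.+1 x %| monic_of v) norm_char (monic_of v)).
  under eq_bigr => i _ do rewrite big_seq.
  under eq_bigr => i _ do under eq_bigr => x xi do
    rewrite (eq_bigl _ _ (fun v => Pdvd i x (monic_of v) (ltn_ord i) xi)) big_mkcond.
  under eq_bigr => i _ do rewrite -big_seq exchange_big.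
  rewrite exchange_big /L_coef mulr_sumr; apply: eq_bigr => v _.
  rewrite -{1}(count_orbit_divisors iota (monic_of_monic v) (size_monic_of v)).
  rewrite natr_sum mulr_suml; apply: eq_bigr => i _.
  by rewrite -[RHS]big_mkcond big_const_seq iter_addr_0 mulr_natl.
apply: eq_bigr => i _; rewrite /S /lifted_char_sum mulr_suml !big_seq.
apply: eq_bigr => x xi.
rewrite (sum_monic_multiples _ (monic_orbit_poly_down _ xi) (size_orbit_poly_down _ xi)) //.
rewrite -norm_char_orbit_poly // /L_coef mulr_sumr.
by apply: eq_bigr => u _; rewrite norm_charM.
Qed.

End LFunction.

(** * Power sums *)

Lemma closed_poly_prod_1sub (C : closedFieldType) (p : {poly C}) : p`_0 = 1 ->
  exists2 ws : seq C, (size ws < size p)%N & p = \prod_(w <- ws) (1 - w *: 'X).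
Proof.
move=> p0; have [zs E] := closed_field_poly_normal p.
have pn0 : p != 0 by apply: contraTneq (oner_neq0 C) => p00; rewrite -p0 p00 coef0 eqxx.
have lc0 : lead_coef p != 0 by rewrite lead_coef_eq0.
have zs0 z : z \in zs -> z != 0.
  move=> zzs; apply: contraTneq zzs => ->.
  by rewrite -root_prod_XsubC -(rootZ _ _ lc0) -E rootE horner_coef0 p0 oner_neq0.
exists [seq z^-1 | z <- zs].
  by rewrite size_map E size_scale // (size_prod_XsubC _ (fun z => z)).
have E2 : p = (lead_coef p * \prod_(z <- zs) (- z)) *: \prod_(w <- [seq z^-1 | z <- zs]) (1 - w *: 'X).
  rewrite {1}E -scalerA; congr (_ *: _); rewrite big_map -scaler_prod !big_seq.
  apply: eq_bigr => z /zs0 z0; rewrite scalerBr scalerA mulNr mulfV // scaleN1r opprK.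
  by rewrite scaleNr -[z%:P]mulr1 mul_polyC addrC.
have E0 : (\prod_(w <- [seq z^-1 | z <- zs]) (1 - w *: 'X : {poly C}))`_0 = 1.
  rewrite -horner_coef0 horner_prod big1 // => w _.
  by rewrite !hornerE ?mulr0 ?subr0.
by move: p0; rewrite {1}E2 coefZ E0 mulr1 => c1; rewrite {1}E2 c1 scale1r.
Qed.

Section Newton.
Variable C : comNzRingType.
Implicit Types (ws : seq C) (p : {poly C}).

Definition power_sum ws r := \sum_(w <- ws) w ^+ r.

(** The logarithmic derivative of the product, truncated at 'X^N to stay within polynomials: each
    factor contributes a finite geometric sum. *)
Lemma newton_poly ws N : exists h,
  (\prod_(w <- ws) (1 - w *: 'X)) * \poly_(i < N) power_sum ws i.+1
    + (\prod_(w <- ws) (1 - w *: 'X))^`() = 'X^N * h.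
Proof.
elim: ws => [|w ws [h IHws]].
  exists 0; rewrite big_nil derivE mulr0 addr0 mul1r.
  apply/polyP => i; rewrite coef_poly coef0; case: ifP => // _.
  by rewrite /power_sum big_nil.
rewrite big_cons derivM; set P := \prod_(_ <- _) _ in IHws *.
have -> : \poly_(i < N) power_sum (w :: ws) i.+1 =
    \poly_(i < N) w ^+ i.+1 + \poly_(i < N) power_sum ws i.+1.
  apply/polyP => i; rewrite coefD !coef_poly; case: ifP => _; last by rewrite addr0.
  by rewrite /power_sum big_cons.
have geo : (1 - w *: 'X) * \poly_(i < N) w ^+ i.+1 = w%:P - (w ^+ N.+1)%:P * 'X^N.
  have -> : \poly_(i < N) w ^+ i.+1 = w%:P * \sum_(i < N) (w *: 'X) ^+ i.
    rewrite poly_def mulr_sumr; apply: eq_bigr => i _.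
    by rewrite exprZn mul_polyC scalerA exprS.
  have := subrX1 (w *: 'X) N; rewrite exprZn -mul_polyC; set T := \sum_(i < N) _ => E.
  transitivity (w%:P * - ((w *: 'X - 1) * T)); first by ring.
  by rewrite -E exprS polyCM; ring.
exists (- (w ^+ N.+1)%:P * P + (1 - w *: 'X) * h).
have d1 : (1 : {poly C})^`() = 0 by rewrite -polyC1 derivC.
rewrite derivB derivZ derivX d1 sub0r.
move: IHws geo; set A := \poly_(i < N) w ^+ i.+1; set B := \poly_(i < N) power_sum _ _.
set U := 1 - _ => IHws geo.
have -> : w *: (1 : {poly C}) = w%:P by rewrite -mul_polyC mulr1.
transitivity ((U * A - w%:P) * P + U * (P * B + P^`())); first by ring.
by rewrite geo IHws; ring.
Qed.

Lemma newton_identity ws m p : p = \prod_(w <- ws) (1 - w *: 'X) ->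
  \sum_(i < m) power_sum ws i.+1 * p`_(m - i.+1) = - (m%:R * p`_m).
Proof.
move=> pE; case: m => [|m]; first by rewrite big_ord0 mul0r oppr0.
have [h E] := newton_poly ws m.+1; rewrite -pE in E.
have := congr1 (fun g : {poly C} => g`_m) E.
rewrite coefD coef_deriv coefXnM ltnSn mulrC coefM => /eqP; rewrite addr_eq0 => /eqP.
rewrite mulr_natl => <-; apply: eq_bigr => i _.
by rewrite coef_poly ltn_ord subSS.
Qed.

End Newton.

(* L(T) (1 - q T) is a polynomial of degree at most D; its zero at T = 1/q, if any,
   is not excluded here, the growth of S takes care of it. *)
Lemma log_derivative_power_sums (C : closedFieldType) (q : C) (D : nat) (c S : nat -> C) :
    c 0%N = 1 -> (forall m, (D <= m)%N -> c m.+1 = q * c m) ->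
    (forall m, m%:R * c m = \sum_(i < m) S i.+1 * c (m - i.+1)%N) ->
  exists2 ws : seq C, (size ws <= D)%N &
    forall r, (0 < r)%N -> S r = q ^+ r - power_sum ws r.
Proof.
move=> c0 crec cS.
(* The coefficients of L(T) (1 - q T), whose logarithmic derivative, times T, has the coefficients
   S_r - q^r. *)
pose P m := if m is m'.+1 then c m - q * c m' else 1.
have P0 m : (D < m)%N -> P m = 0 by case: m => // m /crec /= ->; rewrite subrr.
have PS m : m%:R * P m = \sum_(i < m) (S i.+1 - q ^+ i.+1) * P (m - i.+1)%N.
  case: m => [|m]; first by rewrite big_ord0 mul0r.
  under eq_bigr => i _ do rewrite mulrBl subSS.
  rewrite sumrB.
  have -> : \sum_(i < m.+1) S i.+1 * P (m - i)%N = m.+1%:R * c m.+1 - q * (m%:R * c m).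
    rewrite !cS big_ord_recr subnn [in RHS]big_ord_recr /= subSS subnn c0.
    rewrite addrAC mulr_sumr -sumrB; congr (_ + _); apply: eq_bigr => i _.
    rewrite !subSS -(prednK (_ : 0 < m - i)%N) ?subn_gt0 // /P.
    by rewrite -subnS mulrBr [S _ * (q * _)]mulrCA.
  have -> : \sum_(i < m.+1) q ^+ i.+1 * P (m - i)%N = q * c m.
    elim: m => [|m IHm]; first by rewrite big_ord1 subn0 c0 expr1.
    rewrite big_ord_recl subn0 expr1 /=.
    under eq_bigr => i _ do rewrite /bump add1n subSS exprS -mulrA.
    by rewrite -mulr_sumr IHm -mulrDr subrK.
  by rewrite /P mulrBr mulrCA -addrA; congr (_ + _); rewrite -natr1; ring.
pose p := \poly_(i < D.+1) P i.
have pE i : p`_i = P i.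
  by rewrite coef_poly ltnS; case: leqP => // /P0.
have [|ws sws Ep] := @closed_poly_prod_1sub C p; first by rewrite pE.
exists ws; first by rewrite -ltnS (leq_trans sws) // size_poly.
(* S_r - q^r and the negated power sums satisfy the same recursion with leading coefficient P 0 = 1,
   which determines them. *)
elim/ltn_ind => r IHr r_gt0.
have := newton_identity r Ep; rewrite pE PS => /eqP.
rewrite -addr_eq0 -big_split /=.
case: r IHr r_gt0 => // r IHr _.
rewrite big_ord_recr big1 ?add0r /= => [|i _].
  rewrite subSS subnn pE !mulr1 => /eqP E.
  rewrite add0r in E; apply/eqP; rewrite -subr_eq0 -[X in _ == X]E; apply/eqP; ring.
by rewrite pE (IHr i.+1) ?ltnS // -mulrDl; ring.
Qed.

Section PowerSumGrowth.
Variable C : archiNumFieldType.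
Implicit Types (s : seq C) (t : C).

Lemma bernoulli (x : C) n : 0 <= x -> 1 + n%:R * x <= (1 + x) ^+ n.
Proof.
move=> x0; elim: n => [|n IHn]; first by rewrite mul0r addr0.
rewrite exprS; apply: le_trans (ler_wpM2l _ IHn); last by rewrite addr_ge0.
have -> : (1 + x) * (1 + n%:R * x) = 1 + n.+1%:R * x + n%:R * (x * x).
  by rewrite -natr1; ring.
by rewrite lerDl !mulr_ge0.
Qed.

Lemma powers_unbounded (x B : C) r0 : 1 < x -> ~ (forall r, (r0 <= r)%N -> x ^+ r <= B).
Proof.
move=> x1 xB; have x0 : 0 < x - 1 by rewrite subr_gt0.
have B0 : 0 <= B / (x - 1).
  apply: divr_ge0; last exact: ltW.
  apply: le_trans (xB r0 (leqnn _)).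
  by rewrite exprn_ge0 // ltW // (lt_trans _ x1).
pose n := maxn r0 (Num.bound (B / (x - 1))).
have nB : B / (x - 1) < n%:R.
  by apply: lt_le_trans (archi_boundP B0) _; rewrite ler_nat leq_maxr.
suff Bx : B < x ^+ n by have := lt_le_trans Bx (xB n (leq_maxl _ _)); rewrite ltxx.
rewrite ltr_pdivrMr // in nB; apply: lt_le_trans nB _.
have := bernoulli n (ltW x0); rewrite [1 + (x - 1)]addrC subrK; apply: le_trans.
by rewrite lerDr ler01.
Qed.

(** A polynomial p vanishing at all other frequencies combines finitely many shifted sums into
    mult(y) p(y) y^r; a non-zero mult(y) would make |y|^r of order t^r. *)
Lemma power_sum_growth s t (mult : C -> C) (c : C) r0 y :
    uniq s -> 0 < t ->
    (forall r, (r0 <= r)%N -> `|\sum_(z <- s) mult z * z ^+ r| <= c * t ^+ r) ->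
  y \in s -> t < `|y| -> mult y = 0.
Proof.
move=> us t0 Hc ys ty; apply/eqP/negPn/negP => my0.
pose p := \prod_(z <- rem y s) ('X - z%:P).
have py : p.[y] != 0.
  by rewrite -rootE root_prod_XsubC mem_rem_uniq // inE eqxx.
have lagrange r : \sum_(a < size p) p`_a * (\sum_(z <- s) mult z * z ^+ (r + a)) =
    mult y * p.[y] * y ^+ r.
  under eq_bigr => a _ do rewrite mulr_sumr.
  rewrite exchange_big /= (big_rem y ys) /= [X in _ + X]big1_seq ?addr0 => [|z].
    rewrite horner_coef mulr_sumr mulr_suml; apply: eq_bigr => a _.
    by rewrite exprD; ring.
  move=> /andP[_ zs]; have : p.[z] = 0 by apply/eqP; rewrite -rootE root_prod_XsubC.
  rewrite horner_coef => p0.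
  transitivity (mult z * z ^+ r * \sum_(a < size p) p`_a * z ^+ a); last by rewrite p0 mulr0.
  rewrite mulr_sumr.
  by apply: eq_bigr => a _; rewrite exprD; ring.
have k0 : 0 < `|mult y * p.[y]| by rewrite normr_gt0 mulf_neq0.
apply: (@powers_unbounded (`|y| / t) ((\sum_(a < size p) `|p`_a| * (c * t ^+ a)) / `|mult y * p.[y]|) r0).
  by rewrite ltr_pdivlMr // mul1r.
move=> r r0r; rewrite ler_pdivlMr // expr_div_n mulrAC ler_pdivrMr ?exprn_gt0 //.
rewrite mulrC -normrX -normrM -lagrange; apply: le_trans (ler_norm_sum _ _ _) _.
rewrite mulr_suml; apply: ler_sum => a _; rewrite normrM -mulrA ler_wpM2l //.
by rewrite -mulrA -exprD [(a + r)%N]addnC; apply: Hc; apply: leq_trans r0r (leq_addr _ _).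
Qed.

(* A frequency of modulus > t would dominate the sums, so q cancels against one
   of the ws and the remaining ones have modulus at most t. *)
Lemma power_sum_bound (ws : seq C) (q t c : C) r0 :
    0 < t -> t < `|q| ->
    (forall r, (r0 <= r)%N -> `|q ^+ r - power_sum ws r| <= c * t ^+ r) ->
  `|q - power_sum ws 1| <= (size ws)%:R * t.
Proof.
move=> t0 tq Hc; pose s := undup (q :: ws).
pose mult (y : C) : C := (y == q)%:R - (count_mem y ws)%:R.
have us : uniq s by apply: undup_uniq.
have sum_count (G : C -> C) :
    \sum_(z <- s) (count_mem z ws)%:R * G z = \sum_(w <- ws) G w.
  transitivity (\sum_(z <- s) \sum_(w <- ws) (w == z)%:R * G w).
    apply: eq_bigr => z _; rewrite -sum1_count natr_sum mulr_suml big_mkcond.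
    by apply: eq_bigr => w _ /=; case: eqP => [->|_]; rewrite ?mul1r ?mul0r.
  rewrite exchange_big /= [RHS]big_seq [LHS]big_seq; apply: eq_bigr => w wws.
  rewrite (bigD1_seq w) //= ?mem_undup ?inE ?wws ?orbT // eqxx mul1r big1 ?addr0 // => z.
  by rewrite eq_sym => /negPf ->; rewrite mul0r.
have multE r : \sum_(z <- s) mult z * z ^+ r = q ^+ r - power_sum ws r.
  under eq_bigr => z _ do rewrite mulrBl.
  rewrite sumrB sum_count; congr (_ - _).
  rewrite (bigD1_seq q) //= ?mem_undup ?mem_head // eqxx mul1r big1 ?addr0 // => z /negPf ->.
  by rewrite mul0r.
have mult0 y : y \in s -> t < `|y| -> mult y = 0.
  by apply: (@power_sum_growth _ t _ c r0) => // r r0r; rewrite multE; apply: Hc.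
have := multE 1%N; rewrite expr1 => <-; apply: le_trans (ler_norm_sum _ _ _) _.
have -> : (size ws)%:R * t = \sum_(z <- s) (count_mem z ws)%:R * t.
  by rewrite sum_count big_const_seq count_predT iter_addr_0 mulr_natl.
rewrite big_seq [X in _ <= X]big_seq; apply: ler_sum => z zs; rewrite expr1.
have [tz|zt] := real_ltP (gtr0_real t0) (normr_real z).
  by rewrite mult0 // mul0r normr0 mulr_ge0 // ltW.
have nzq : z != q by apply: contraTneq tq => <-; rewrite (le_gtF zt).
by rewrite /mult (negPf nzq) sub0r normrM normrN normr_nat ler_wpM2l.
Qed.

End PowerSumGrowth.

(** * Weil's bound *)

Section Weil.
Variables (F : finFieldType) (K : closedFieldType) (iota : {rmorphism F -> K}).
Local Notation q := #|F|.

Lemma sum_frob_points1 (R : nmodType) (G : F -> R) :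
  \sum_(x <- frob_points F K 1) G (descend iota x) = \sum_a G a.
Proof.
have : perm_eq (frob_points F K 1) [seq iota a | a <- enum F].
  apply: uniq_perm; first exact: uniq_frob_points.
    by rewrite map_inj_uniq ?enum_uniq //; apply: fmorph_inj.
  move=> x; rewrite mem_frob_points // expn1.
  apply/(frob_fixedP iota)/mapP => [[a ->]|[a _ ->]]; exists a => //.
  by rewrite mem_enum.
move=> E; rewrite (perm_big _ E) big_map big_enum; apply: eq_bigr => a _.
by rewrite descendK.
Qed.

Lemma exists_char_poly (f : {poly F}) D : f \is monic -> size f = D.+1 ->
  exists A : 'M[F]_D, char_poly A = f.
Proof.
move=> mf sf; have := companionmxK mf; move: (companionmx f).
by rewrite sf /= => A EA; exists A.
Qed.

Lemma indecomposable_scale d (c : K) (f : {poly K}) :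
  c != 0 -> indecomposable_mod d f -> indecomposable_mod d (c *: f).
Proof.
by move=> c0 H w Hw; apply: H => a; rewrite -(mup_scale _ _ c0).
Qed.

Section Monic.
Variables (D' : nat) (A : 'M[F]_D'.+1) (psi : F -> algC).
Hypothesis psiP : mult_char psi.
Let f := (-1) ^+ D'.+1 *: char_poly A.
Hypothesis f_ind : indecomposable_mod q.-1 (map_poly iota f).

Lemma weil_bound_char_poly :
  `|\sum_a psi f.[a]| <= D'.+1%:R * sqrtC q%:R.
Proof.
pose S r := lifted_char_sum iota f psi r.
have sf : size f = D'.+2.
  by rewrite size_scale ?size_char_poly // expf_neq0 // oppr_eq0 oner_neq0.
have [ws sws SE] := log_derivative_power_sums (L_coef0 A psiP) (L_coef_rec A psi)
  (L_coef_log_derivative iota A psiP).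
have {}SE : forall r, (0 < r)%N -> S r = q%:R ^+ r - power_sum ws r := SE.
have S1 : S 1%N = \sum_a psi f.[a].
  rewrite -sum_frob_points1 /S /lifted_char_sum !big_seq; apply: eq_bigr => x.
  rewrite mem_frob_points // expn1 => /(frob_fixedP iota)[a ->].
  rewrite /norm_exp big_ord1 expn0 expr1 horner_map /=.
  by rewrite !descendK.
pose t : algC := sqrtC q%:R.
have q1 : 1 < q%:R :> algC by rewrite ltr1n card_gt1.
have t1 : 1 < t by rewrite -sqrtC1 ltr_sqrtC ?nnegrE ?ler0n ?ler01.
have t0 : 0 < t by apply: lt_trans t1.
have tt : t ^+ 2 = q%:R by rewrite sqrtCK.
have [c SB] := lifted_char_sum_bound sf psiP f_ind.
have : `|q%:R - power_sum ws 1| <= (size ws)%:R * t.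
  (* Since [uphalf r] <= (r + 1) / 2, q^(uphalf r) is at most t^(r+1); the extra t goes into the
     constant. *)
  apply: (@power_sum_bound _ ws q%:R t (c%:R * t) (2 * (q * D'.+1) + 7)%N) => // [|r r0].
    rewrite normr_nat -tt expr2 ltr_pMl //.
  have r_gt0 : (0 < r)%N by lia.
  rewrite -SE //; apply: le_trans (SB r _) _; first by lia.
  rewrite natrM -mulrA ler_wpM2l ?ler0n // -exprS natrX -tt -exprM.
  rewrite ler_weXn2l ?(ltW t1) //; have := odd_double_half r.
  by rewrite uphalf_half; case: (odd r); lia.
rewrite -S1 SE // expr1; move/le_trans; apply.
by rewrite ler_pM2r // ler_nat.
Qed.

End Monic.

Theorem weil_bound (f : {poly F}) (D : nat) (psi : F -> algC) :
    mult_char psi -> size f = D.+1 -> (0 < D)%N ->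
    indecomposable_mod q.-1 (map_poly iota f) ->
  `|\sum_a psi f.[a]| <= D%:R * sqrtC q%:R.
Proof.
case: D => // D' psiP sf _ f_ind.
have f0 : f != 0 by rewrite -size_poly_eq0 sf.
have lc0 : lead_coef f != 0 by rewrite lead_coef_eq0.
pose f1 := (lead_coef f)^-1 *: f.
have mf1 : f1 \is monic by rewrite monicE lead_coefZ mulVf.
have sf1 : size f1 = D'.+2 by rewrite size_scale ?invr_eq0.
have [A EA] := exists_char_poly mf1 sf1.
(* Normalising sign and leading coefficient multiplies the sum by psi(c), of modulus 1. *)
pose c := (-1) ^+ D'.+1 * (lead_coef f)^-1.
have c0 : c != 0 by rewrite mulf_neq0 ?invr_eq0 // expf_neq0 // oppr_eq0 oner_neq0.
have Ef : (-1) ^+ D'.+1 *: char_poly A = c *: f by rewrite EA scalerA.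
have := @weil_bound_char_poly D' A psi psiP; rewrite Ef map_polyZ /=.
move=> /(_ (indecomposable_scale _ f_ind)); rewrite fmorph_eq0 => /(_ c0).
have [_ _ psiM psiN _] := psiP.
have -> : \sum_a psi (c *: f).[a] = psi c * \sum_a psi f.[a].
  by rewrite mulr_sumr; apply: eq_bigr => a _; rewrite hornerZ psiM.
by rewrite normrM psiN // mul1r.
Qed.

Lemma monic_eq_mup (p r : {poly K}) :
  p \is monic -> r \is monic -> (forall a, mup a p = mup a r) -> p = r.
Proof.
move=> mp mr E.
have [s Es] := closed_field_poly_normal p; have [u Eu] := closed_field_poly_normal r.
rewrite (monicP mp) scale1r in Es; rewrite (monicP mr) scale1r in Eu.
rewrite Es Eu; apply: perm_big; apply/allP => a _ /=.
by rewrite -!mu_prod_XsubC -Es -Eu E.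
Qed.

(** The monic d-th root over [K] is determined by its multiplicities, hence fixed by Frobenius,
    hence defined over [F]. *)
Lemma descend_power (f : {poly F}) d : f != 0 -> (0 < d)%N ->
    (forall a, d %| mup a (map_poly iota f))%N ->
  exists g : {poly F}, f = lead_coef f *: g ^+ d.
Proof.
move=> f0 d_gt0 Hd; set fK := map_poly iota f in Hd *.
have fK0 : fK != 0 by rewrite map_poly_eq0.
have [rs E] := closed_field_poly_normal fK.
pose G := \prod_(z <- undup rs) ('X - z%:P) ^+ (count_mem z rs %/ d)%N.
have mG : G \is monic by apply: monic_prod => z _; apply/monic_exp/monicXsubC.
have lcK0 : lead_coef fK != 0 by rewrite lead_coef_eq0.
have mupE a : mup a fK = count_mem a rs by rewrite E mup_scale // mu_prod_XsubC.
have GE : fK = lead_coef fK *: G ^+ d.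
  rewrite {1}E; congr (_ *: _); rewrite /G -prodrXl.
  rewrite -(big_undup_iterop_count _ rs xpredT) /=; apply: eq_bigr => z _.
  by rewrite -exprM divnK // -mupE.
have phiG : map_poly (frob iota) G = G.
  have mpG : map_poly (frob iota) G \is monic by rewrite map_monic.
  apply: monic_eq_mup => // a; apply/eqP; rewrite -(eqn_pmul2l d_gt0).
  rewrite -!mup_exp ?monic_neq0 // -(mup_scale _ _ lcK0) -[X in _ == X](mup_scale _ _ lcK0).
  rewrite -GE -[X in _ == mup _ X](map_frob_map_iota iota f) -/fK {2}GE.
  rewrite map_polyZ rmorphXn /=.
  have -> : frob iota (lead_coef fK) = lead_coef fK.
    by rewrite lead_coef_map /frob -rmorphXn /= expf_card.
  by [].
exists (map_poly (descend iota) G).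
apply: (map_poly_inj iota); rewrite map_polyZ rmorphXn /= map_poly_descendK // -lead_coef_map.
exact: GE.
Qed.

(** Put d' = d / gcd(d, w). It divides all multiplicities of f, so h is a constant times a (d' l)-th
    power, and maximality of [l] forces d' = 1. *)
Lemma largest_exponent_indecomposable (h f : {poly F}) (l : nat) (C : {unit F}) d :
    largest_exponent h l -> h = val C *: f ^+ l -> h != 0 -> (0 < d)%N ->
  indecomposable_mod d (map_poly iota f).
Proof.
move=> [l_gt0 _ lmax] hE h0 d_gt0 w Hw.
have f0 : f != 0.
  by apply: contraNneq h0 => f0; rewrite hE f0 expr0n eqn0Ngt l_gt0 /= scaler0.
pose d' := (d %/ gcdn d w)%N.
have g_gt0 : (0 < gcdn d w)%N by rewrite gcdn_gt0 d_gt0.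
have d'_gt0 : (0 < d')%N by rewrite divn_gt0 // dvdn_leq // dvdn_gcdl.
have Hd' a : (d' %| mup a (map_poly iota f))%N.
  have E1 : d = (d' * gcdn d w)%N by rewrite divnK ?dvdn_gcdl.
  have E2 : w = (w %/ gcdn d w * gcdn d w)%N by rewrite divnK ?dvdn_gcdr.
  have := Hw a; rewrite [X in (X %| _)%N]E1 [X in (_ %| X * _)%N]E2 mulnAC dvdn_pmul2r // Gauss_dvdr //.
  rewrite /coprime -(eqn_pmul2r g_gt0) muln_gcdl mul1n.
  by rewrite !divnK ?dvdn_gcdl ?dvdn_gcdr.
have [g gE] := descend_power f0 d'_gt0 Hd'.
have lc0 : lead_coef f != 0 by rewrite lead_coef_eq0.
have cU : val C * lead_coef f ^+ l \is a GRing.unit.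
  by rewrite unitrM (valP C) unitrX // unitfE.
have : scaled_power h (d' * l).
  exists (FinRing.unit F cU), g.
  by rewrite hE {1}gE exprZn scalerA -exprM.
move/(lmax _ _); rewrite muln_gt0 d'_gt0 l_gt0 => /(_ isT).
rewrite -[X in (_ <= X)%N]mul1n leq_pmul2r // => d'1.
have : d = gcdn d w by rewrite -{1}(divnK (dvdn_gcdl d w)) -/d'; nia.
by move=> ->; apply: dvdn_gcdr.
Qed.

End Weil.

(** * Orthogonality of characters *)

Section ExtendedCharacters.
Variable F : finFieldType.
Local Notation U := {unit F}.

Definition ext_char (chi : U -> algC) (a : F) : algC :=
  if (insub a : option U) is Some u then chi u else 0.

Lemma ext_char_val chi (u : U) : ext_char chi (val u) = chi u.
Proof. by rewrite /ext_char valK. Qed.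

Lemma ext_char0 chi : ext_char chi 0 = 0.
Proof. by rewrite /ext_char insubF // unitr0. Qed.

Lemma unit_of_neq0 (a : F) : a != 0 -> exists u : U, a = val u.
Proof. by move=> a0; have aU : a \is a GRing.unit by [rewrite unitfE]; exists (FinRing.Unit aU). Qed.

Lemma mult_char_ext (chi : U -> algC) (u0 : U) :
    (forall u v : U, chi (u * v)%g = chi u * chi v) -> (forall u, `|chi u| = 1) ->
    chi u0 != 1 -> mult_char (ext_char chi).
Proof.
move=> chiM chiN chi1.
have chi_1 : chi 1%g = 1.
  have E := chiM 1%g 1%g; rewrite mulg1 in E.
  have c0 : chi 1%g != 0 by rewrite -normr_eq0 chiN oner_neq0.
  by apply: (mulfI c0); rewrite -E mulr1.
have extM a b : ext_char chi (a * b) = ext_char chi a * ext_char chi b.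
  have [->|/unit_of_neq0[u ->]] := eqVneq a 0; first by rewrite mul0r !ext_char0 mul0r.
  have [->|/unit_of_neq0[v ->]] := eqVneq b 0; first by rewrite mulr0 !ext_char0 mulr0.
  by rewrite -FinRing.val_unitM !ext_char_val chiM.
split=> //; first exact: ext_char0.
- by have := ext_char_val chi 1%g; rewrite /= => ->.
- by move=> a /unit_of_neq0[u ->]; rewrite ext_char_val.
have u0N : val u0 != 0 by rewrite -unitfE (valP u0).
have : \sum_a ext_char chi a = chi u0 * \sum_a ext_char chi a.
  rewrite mulr_sumr [LHS](reindex_inj (mulfI u0N)); apply: eq_bigr => a _.
  by rewrite extM ext_char_val.
move/eqP; rewrite -subr_eq0 -[X in X - _]mul1r -mulrBl mulf_eq0 subr_eq0 eq_sym.
by rewrite (negPf chi1) => /eqP.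
Qed.

End ExtendedCharacters.

Section UnitGroup.
Variables (F : finFieldType) (H : {group {unit F}}) (n : nat).
Hypothesis indexH : #|[set: {unit F}] : H|%g = n.

Lemma mem_index_subgroup (x : {unit F}) :
  (x \in H) <-> exists u : {unit F}, x = (u ^+ n)%g.
Proof.
have cG := field_unit_group_cyclic [set: {unit F}]%G.
have /cyclicP[g gE] := cG.
have og : #[g]%g = #|[set: {unit F}]| by rewrite orderE -gE.
have n_dvd : (n %| #[g]%g)%N by rewrite og -indexH dvdn_indexg.
have n_gt0 : (0 < n)%N by rewrite -indexH indexg_gt0.
have HE : H :=: <[(g ^+ n)%g]>%g.
  apply/eqP; rewrite (eq_subG_cyclic cG) ?subsetT // -orderE orderXdiv // og.
  by rewrite -(Lagrange (subsetT H)) indexH mulnK.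
split=> [|[u ->]].
  rewrite HE => /cycleP[j ->]; exists (g ^+ j)%g.
  by rewrite -!expgM mulnC.
have : u \in <[g]>%g by rewrite -gE inE.
by case/cycleP => j ->; rewrite -expgM mulnC expgM HE mem_cycle.
Qed.

(** Bezout makes n a multiple of l modulo q - 1, and u^(q-1) = 1. *)
Lemma mem_index_subgroup_gcd l (x : {unit F}) : (0 < l)%N -> n = gcdn l #|F|.-1 ->
  x \in H -> exists u : {unit F}, x = (u ^+ l)%g.
Proof.
move=> l_gt0 nE /mem_index_subgroup[u ->].
have [a _ /dvdnP[b E]] := Bezoutl #|F|.-1 l_gt0.
exists (u ^+ b)%g; rewrite -expgM -E -nE expgD mulnC expgM.
have -> : (u ^+ #|F|.-1 = 1)%g.
  by rewrite -card_finField_unit; apply/eqP; rewrite -order_dvdn order_dvdG ?inE.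
by rewrite expg1n mulg1.
Qed.

End UnitGroup.

Lemma algebraic_closure (F : finFieldType) : {K : closedFieldType & {rmorphism F -> K}}.
Proof. by have [K [iota _]] := countable_algebraic_closure F; exists K; exact: iota. Qed.

Section Fourier.
Variables (F : finFieldType) (h f : {poly F}) (D l n : nat) (C : {unit F}).
Variable H : {group {unit F}}.
Hypotheses (sh : size h = D.+1) (D_gt0 : (0 < D)%N) (hl : largest_exponent h l).
Hypotheses (hE : h = val C *: f ^+ l) (nE : n = gcdn l #|F|.-1).
Hypothesis indexH : #|[set: {unit F}] : H|%g = n.
Local Notation q := #|F|.
Local Notation U := {unit F}.
Local Notation G := [set: {unit F}]%G.

Let l_gt0 : (0 < l)%N. Proof. by case: hl. Qed.
Let h0 : h != 0. Proof. by rewrite -size_poly_eq0 sh. Qed.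

Let Df := (size f).-1.

Let f0 : f != 0.
Proof.
by apply: contraNneq h0 => f0; rewrite hE f0 expr0n eqn0Ngt l_gt0 /= scaler0.
Qed.

Let sf : size f = Df.+1.
Proof. by rewrite prednK // lt0n size_poly_eq0. Qed.

Let DE : D = (l * Df)%N.
Proof.
have := size_exp f l; rewrite -(size_scale (f ^+ l) (_ : val C != 0)).
  by rewrite -hE sh sf /= mulnC.
by rewrite -unitfE (valP C).
Qed.

Lemma exponent_le_degree : (l <= D)%N.
Proof. by rewrite DE leq_pmulr //; case: Df DE D_gt0 => // ->; rewrite muln0. Qed.

Let lin (i : Iirr G) : 'chi_i \is a linear_char.
Proof. exact/char_abelianP/cyclic_abelian/field_unit_group_cyclic. Qed.

Let chiM i (u v : U) : 'chi[G]_i (u * v)%g = 'chi[G]_i u * 'chi[G]_i v.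
Proof. by rewrite (lin_charM (lin i)) ?inE. Qed.

Let chiN i (u : U) : `|'chi[G]_i u| = 1.
Proof. by rewrite (normC_lin_char (lin i)) ?inE. Qed.

Let Z i := \sum_z ext_char 'chi[G]_i h.[z].

Let Z_bound i : (exists2 x, x \in H & 'chi[G]_i x != 1) -> `|Z i| <= D%:R * sqrtC q%:R.
Proof.
move=> [x /(mem_index_subgroup_gcd indexH l_gt0 nE)[u ->] chi1].
pose psi := fun v : U => 'chi[G]_i v ^+ l.
have psiP : mult_char (ext_char psi).
  apply: (@mult_char_ext _ psi u).
  - by move=> v w; rewrite /psi chiM exprMn.
  - by move=> v; rewrite /psi normrX chiN expr1n.
  - by rewrite /psi -(lin_charX (lin i)) ?inE.
have -> : Z i = 'chi[G]_i C * \sum_z ext_char psi f.[z].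
  rewrite /Z mulr_sumr; apply: eq_bigr => z _; rewrite hE hornerZ horner_exp.
  have [->|/unit_of_neq0[v ->]] := eqVneq f.[z] 0.
    by rewrite expr0n eqn0Ngt l_gt0 !mulr0 !ext_char0 mulr0.
  rewrite -FinRing.val_unitX -FinRing.val_unitM !ext_char_val chiM.
  by rewrite (lin_charX (lin i)) ?inE.
rewrite normrM chiN mul1r.
have [K iota] := algebraic_closure F.
have q_gt1 := card_gt1 F.
apply: (@le_trans _ _ (Df%:R * sqrtC q%:R)).
  apply: (@weil_bound F K iota) => //.
    by case: Df DE D_gt0 => // ->; rewrite muln0.
  have d_gt0 : (0 < q.-1)%N by lia.
  exact: largest_exponent_indecomposable hl hE h0 d_gt0.
rewrite ler_wpM2r ?sqrtC_ge0 ?ler0n // ler_nat DE.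
exact: leq_pmull.
Qed.

Section NoSolutions.
Variables (X Y : {set U}) (c : U) (m : nat).
Hypotheses (cX : #|X| = m) (cY : #|Y| = m).
Hypothesis XYH : forall x y, x \in X -> y \in Y -> (c * x * y * C^-1)%g \in H.
Hypothesis no_solution : forall x y z, x \in X -> y \in Y -> val (c * x * y)%g != h.[z].

Let hat (A : {set U}) i := \sum_(x in A) 'chi[G]_i x.

Let orthogonality (u v : U) : \sum_i 'chi[G]_i u * ('chi[G]_i v)^* = (q.-1 * (u == v))%:R.
Proof.
have abG : abelian G by exact/cyclic_abelian/field_unit_group_cyclic.
rewrite second_orthogonality_relation ?inE //.
have -> : 'C_(G)[u]%g = G.
  apply/setIidPl/subsetP => w _; apply/cent1P.
  by apply: (centsP abG); rewrite inE.
rewrite card_finField_unit -mulr_natl -natrM mulnC; congr ((_ * nat_of_bool _)%:R).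
apply/imsetP/eqP => [[w _ ->]|->]; last by exists 1%g; rewrite ?inE ?conjg1.
by rewrite conjgE (centsP abG v _ w) ?inE // mulKg.
Qed.

Let parseval (A : {set U}) : \sum_i `|hat A i| ^+ 2 = (q.-1 * #|A|)%:R.
Proof.
transitivity (\sum_i \sum_(x in A) \sum_(y in A) 'chi[G]_i x * ('chi[G]_i y)^*).
  apply: eq_bigr => i _; rewrite normCK /hat rmorph_sum mulr_suml.
  by apply: eq_bigr => x _; rewrite mulr_sumr.
rewrite exchange_big /= natrM mulr_natr -sumr_const; apply: eq_bigr => x xA.
rewrite exchange_big /= (bigD1 x) //= orthogonality eqxx muln1 big1 ?addr0 // => y /andP[_ yx].
by rewrite orthogonality eq_sym (negPf yx) muln0.
Qed.

Let T i := 'chi[G]_i c * hat X i * hat Y i * (Z i)^*.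

Let T_expand i : T i = \sum_z \sum_(x in X) \sum_(y in Y)
  'chi[G]_i (c * x * y)%g * (ext_char 'chi[G]_i h.[z])^*.
Proof.
rewrite /T /Z rmorph_sum mulr_sumr; apply: eq_bigr => z _.
rewrite /hat [_ c * _]mulr_sumr !mulr_suml; apply: eq_bigr => x _.
rewrite mulr_sumr mulr_suml; apply: eq_bigr => y _.
by rewrite !chiM.
Qed.

(** By orthogonality the sum counts, up to a factor q - 1, the solutions of c x y = h(z); points
    with h(z) = 0 contribute 0 to every character. *)
Let sum_T : \sum_i T i = 0.
Proof.
under eq_bigr => i _ do rewrite T_expand.
rewrite exchange_big big1 //= => z _; rewrite exchange_big big1 //= => x xX.
rewrite exchange_big big1 //= => y yY.
have [hz|/unit_of_neq0[v hz]] := eqVneq h.[z] 0.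
  by rewrite big1 // => i _; rewrite hz ext_char0 conjC0 mulr0.
under eq_bigr => i _ do rewrite hz ext_char_val.
rewrite orthogonality; have := no_solution z xX yY; rewrite hz.
by rewrite (inj_eq val_inj) => /negPf ->; rewrite muln0.
Qed.

Let nz := #|[set z : F | h.[z] != 0]|.

(** Non-zero values h(z) and all c x y lie in C H, where a character trivial on [H] is constant. *)
Let T_trivial i : (forall x, x \in H -> 'chi[G]_i x = 1) -> T i = (m * m * nz)%:R.
Proof.
move=> triv; rewrite T_expand (bigID (fun z => h.[z] != 0)) /= addrC big1 ?add0r; last first.
  move=> z; rewrite negbK => /eqP ->; rewrite big1 // => x _; rewrite big1 // => y _.
  by rewrite ext_char0 conjC0 mulr0.
rewrite (eq_bigr (fun=> (m * m)%:R)) => [|z hz].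
  by rewrite sumr_const -[X in _ *+ X]cardsE -/nz -mulrnA.
rewrite (eq_bigr (fun=> m%:R)) => [|x xX]; first by rewrite sumr_const cX -mulrnA.
rewrite (eq_bigr (fun=> 1)) => [|y yY]; first by rewrite sumr_const cY.
have fz : f.[z] != 0.
  by apply: contraNneq hz => fz; rewrite hE hornerZ horner_exp fz expr0n eqn0Ngt l_gt0 mulr0.
have [v fv] := unit_of_neq0 fz.
have -> : h.[z] = val (C * v ^+ l)%g.
  by rewrite hE hornerZ horner_exp fv FinRing.val_unitM FinRing.val_unitX.
rewrite ext_char_val.
have vH : (v ^+ l)%g \in H.
  apply/(mem_index_subgroup indexH); rewrite nE.
  exists (v ^+ (l %/ gcdn l q.-1))%g.
  by rewrite -expgM divnK // dvdn_gcdl.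
have -> : (c * x * y = (c * x * y * C^-1) * C)%g by rewrite mulgKV.
rewrite (chiM i (c * x * y * C^-1)%g C) (triv _ (XYH xX yY)).
rewrite (chiM i C (v ^+ l)%g) (triv _ vH) mul1r mulr1.
by rewrite -normCK chiN expr1n.
Qed.

Let nz_ge : (q <= nz + D)%N.
Proof.
have <- : #|[set: F]| = q by rewrite cardsT.
rewrite -(cardsID [set z : F | h.[z] != 0] setT) setTI leq_add2l.
have := @max_poly_roots _ h (enum ([set: F] :\: [set z : F | h.[z] != 0])) h0.
rewrite enum_uniq -cardE sh ltnS; apply=> //.
by apply/allP => z; rewrite mem_enum !inE negbK andbT.
Qed.

Lemma fourier_bound : (m * (q - D))%:R <= D%:R * sqrtC q%:R * q%:R :> algC.
Proof.
have [->|m_gt0] := posnP m; first by rewrite mul0n mulr_ge0 ?mulr_ge0 ?sqrtC_ge0 ?ler0n.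
pose triv i := [forall x in H, 'chi[G]_i x == 1].
have trivP i : triv i -> T i = (m * m * nz)%:R.
  by move=> /forall_inP ti; apply: T_trivial => x /ti/eqP.
have ntrivP i : ~~ triv i -> `|T i| <= D%:R * sqrtC q%:R * (`|hat X i| * `|hat Y i|).
  rewrite negb_forall => /existsP[x]; rewrite negb_imply => /andP[xH x1].
  rewrite /T !normrM chiN mul1r norm_conjC mulrC ler_wpM2r ?mulr_ge0 //.
  by apply: Z_bound; exists x.
have triv0 : triv 0.
  by apply/forall_inP => x _; rewrite irr0 cfun1E inE.
have Dq0 : 0 <= D%:R * sqrtC q%:R :> algC by rewrite mulr_ge0 ?sqrtC_ge0 ?ler0n.
(* As [X] and [Y] have equal size, this with Parseval does the work of Cauchy-Schwarz. *)
have amgm i : 2%:R * (`|hat X i| * `|hat Y i|) <= `|hat X i| ^+ 2 + `|hat Y i| ^+ 2.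
  rewrite -subr_ge0.
  have -> : `|hat X i| ^+ 2 + `|hat Y i| ^+ 2 - 2%:R * (`|hat X i| * `|hat Y i|) =
    (`|hat X i| - `|hat Y i|) ^+ 2 by ring.
  by rewrite real_exprn_even_ge0 // rpredB ?normr_real.
have sumXY : \sum_(i | ~~ triv i) `|hat X i| * `|hat Y i| <= (q * m)%:R.
  rewrite -(ler_pM2l (_ : 0 < 2%:R)) ?ltr0n // mulr_sumr.
  apply: (@le_trans _ _ (\sum_i (`|hat X i| ^+ 2 + `|hat Y i| ^+ 2))).
    rewrite [X in _ <= X](bigID triv) /= -[X in X <= _]add0r; apply: lerD.
      by apply: sumr_ge0 => i _; rewrite addr_ge0 // exprn_ge0.
    by apply: ler_sum => i _; apply: amgm.
  rewrite big_split /= !parseval cX cY -natrD -natrM ler_nat.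
  by rewrite mul2n -addnn leq_add // leq_mul2r leq_pred orbT.
have main : (m * m * nz)%:R <= D%:R * sqrtC q%:R * (q * m)%:R :> algC.
  (* All terms with [triv i] are non-negative, so the principal character alone gives the lower
     bound. *)
  apply: (@le_trans _ _ (\sum_(i | triv i) T i)).
    rewrite (bigD1 0) //= trivP // lerDl; apply: sumr_ge0 => i /andP[ti _].
    by rewrite trivP.
  have : \sum_(i | triv i) T i = - \sum_(i | ~~ triv i) T i.
    by have := sum_T; rewrite (bigID triv) /= => /eqP; rewrite addr_eq0 => /eqP.
  move=> E; have T0 : 0 <= \sum_(i | triv i) T i.
    by apply: sumr_ge0 => i /trivP ->.
  rewrite -(ger0_norm T0) E normrN; apply: le_trans (ler_norm_sum _ _ _) _.
  apply: (@le_trans _ _ (\sum_(i | ~~ triv i) D%:R * sqrtC q%:R * (`|hat X i| * `|hat Y i|))).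
    by apply: ler_sum => i /ntrivP.
  by rewrite -mulr_sumr ler_wpM2l.
have m0 : 0 < m%:R :> algC by rewrite ltr0n.
rewrite -(ler_pM2l m0) -natrM mulnA.
apply: (@le_trans _ _ (m * m * nz)%:R).
  by rewrite ler_nat leq_mul2l leq_subLR addnC nz_ge orbT.
have -> : m%:R * (D%:R * sqrtC q%:R * q%:R) = D%:R * sqrtC q%:R * (q * m)%:R :> algC.
  by rewrite natrM; ring.
exact: main.
Qed.

(* For q >= 2 D, q - D is at least q / 2. *)
Lemma no_solution_card : (2 * D <= q)%N -> (m * m <= 4 * (D * D) * q)%N.
Proof.
move=> qD; have q_gt0 : (0 < q)%N by apply: ltnW (card_gt1 F).
have q0 : 0 < q%:R :> algC by rewrite ltr0n.
have H1 : m%:R <= 2%:R * D%:R * sqrtC q%:R :> algC.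
  rewrite -(ler_pM2r q0).
  apply: (@le_trans _ _ (2%:R * (m * (q - D))%:R)).
    by rewrite -!natrM ler_nat mulnCA leq_mul2l mulnBr; lia.
  by rewrite -!mulrA ler_pM2l ?ltr0n // mulrA; apply: fourier_bound.
have : m%:R ^+ 2 <= (2%:R * D%:R * sqrtC q%:R) ^+ 2 :> algC.
  by rewrite lerXn2r // nnegrE ?mulr_ge0 ?sqrtC_ge0 ?ler0n.
rewrite [X in _ <= X]exprMn sqrtCK -!natrM -!natrX -natrM ler_nat.
by rewrite expnMn -!mulnn.
Qed.

End NoSolutions.
End Fourier.

(** * Cosets of H *)

Lemma exists_subset_card (T : finType) (S : {set T}) m : (m <= #|S|)%N ->
  exists2 X : {set T}, X \subset S & #|X| = m.
Proof.
move=> leqm; exists [set x in take m (enum S)].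
  by apply/subsetP => x; rewrite inE => /mem_take; rewrite mem_enum.
rewrite cardsE (card_uniqP _) ?take_uniq ?enum_uniq // size_take -cardE.
by case: ltngtP leqm.
Qed.

Lemma greedy_representatives (T : finType) (x0 : T) (S : nat -> {set T}) k :
  (forall j, (j < k)%N -> (k <= #|S j|)%N) ->
  exists a : seq T, [/\ size a = k, uniq a & forall j, (j < k)%N -> nth x0 a j \in S j].
Proof.
elim: k S => [|k IHk] S HS; first by exists [::].
have [|a [sa ua aS]] := IHk (fun j => S j.+1).
  by move=> j ltjk; apply: leq_trans (HS j.+1 _).
have /card_gt0P[x] : (0 < #|S 0 :\: [set y in a]|)%N.
  rewrite cardsD subn_gt0; apply: leq_ltn_trans (HS 0 (ltn0Sn k)).
  apply: leq_trans (subset_leq_card (subsetIr _ _)) _.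
  by rewrite cardsE -sa; apply: card_size.
rewrite !inE => /andP[xa xS]; exists (x :: a); rewrite /= sa xa ua; split=> //.
by case=> //= j; rewrite ltnS; apply: aS.
Qed.

Lemma lcoset_mul (gT : finGroupType) (H : {group gT}) (a b x y : gT) : abelian [set: gT] ->
  (x \in a *: H -> y \in b *: H -> x * y \in (a * b) *: H)%g.
Proof.
move=> abT; rewrite !mem_lcoset => xa yb.
have -> : ((a * b)^-1 * (x * y) = (a^-1 * x) * (b^-1 * y))%g.
  rewrite invMg !mulgA; congr (_ * _)%g; rewrite -!mulgA.
  by rewrite (centsP abT b^-1%g _ (a^-1 * x)%g) ?inE // mulgA.
exact: groupM.
Qed.

Section Cosets.
Variables (F : finFieldType) (H : {group {unit F}}) (g : {unit F}) (n : nat).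
Hypothesis indexH : #|[set: {unit F}] : H|%g = n.
Hypothesis gen_g : generator [set: {unit F}] g.
Local Notation U := {unit F}.

Let n_gt0 : (0 < n)%N. Proof. by rewrite -indexH indexg_gt0. Qed.
Let nS : n.-1.+1 = n. Proof. exact: prednK. Qed.

Let powers_g (u : U) : exists j, u = (g ^+ j)%g.
Proof.
have : u \in <[g]>%g by rewrite -(eqP gen_g) inE.
by case/cycleP => j ->; exists j.
Qed.

Lemma expg_mem_subgroup j : (g ^+ j \in H)%g = (n %| j)%N.
Proof.
have og : #[g]%g = #|[set: U]| by rewrite orderE -(eqP gen_g).
have n_dvd : (n %| #[g]%g)%N by rewrite og -indexH dvdn_indexg.
apply/idP/idP => [/(mem_index_subgroup indexH)[u]|/dvdnP[b ->]]; last first.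
  by apply/(mem_index_subgroup indexH); exists (g ^+ b)%g; rewrite -expgM.
have [b ->] := powers_g u; rewrite -expgM => /eqP; rewrite eq_expg_mod_order => /eqP E.
have : j = b * n %[mod n] by rewrite -(modn_dvdm j n_dvd) E modn_dvdm.
by rewrite modnMl /dvdn => ->.
Qed.

Lemma expg_lcoset i j : i = j %[mod n] -> (g ^+ i *: H = g ^+ j *: H)%g.
Proof.
wlog leij : i j / (i <= j)%N.
  by move=> W; case: (leqP i j) => [/W//|/ltnW/W E /esym/E].
move=> /eqP; rewrite eq_sym eqn_mod_dvd // => dvd.
have : (g ^+ (j - i) \in H)%g by rewrite expg_mem_subgroup.
by rewrite -{2}(subnKC leij) expgD lcosetM => /lcoset_id ->.
Qed.

Lemma mem_expg_lcoset (i : Zmod n) j : ((g ^+ j)%g \in (g ^+ i *: H)%g) = (i == inZp j).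
Proof.
have ltin : (i < n)%N by rewrite -[X in (_ < X)%N]nS ltn_ord.
have lein := ltnW ltin.
apply/idP/eqP => [|->]; last first.
  by rewrite (@expg_lcoset _ j) ?lcoset_refl //= nS modn_mod.
case/lcosetP => x xH E; apply: val_inj => /=; rewrite [X in _ = (_ %% X)%N]nS.
have : (g ^+ (n - i + j) \in H)%g.
  rewrite expgD E mulgA -expgD subnK // groupM //.
  by rewrite expg_mem_subgroup.
rewrite expg_mem_subgroup => dvd; rewrite -[LHS](modn_small ltin).
have : i + (n - i + j) = i %[mod n] by rewrite -modnDmr (eqP dvd) addn0.
by rewrite addnA subnKC // modnDl => ->.
Qed.

Lemma sum_mem_lcoset (u : U) : (\sum_(i : Zmod n) (u \in (g ^+ i *: H)%g) = 1)%N.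
Proof.
have [j ->] := powers_g u.
under eq_bigr => i _ do rewrite mem_expg_lcoset.
by rewrite (bigD1 (inZp j)) //= eqxx big1 // => i /negPf ->.
Qed.

Lemma mem_coset_union (B : {set Zmod n}) u :
  (u \in coset_union g H B : nat) = (\sum_(i in B) (u \in (g ^+ i *: H)%g))%N.
Proof.
have [j ->] := powers_g u.
under eq_bigr => i _ do rewrite mem_expg_lcoset.
have -> : ((g ^+ j)%g \in coset_union g H B) = (inZp j \in B).
  apply/bigcupP/idP => [[i iB]|jB]; last by exists (inZp j); rewrite ?mem_expg_lcoset.
  by rewrite mem_expg_lcoset => /eqP <-.
case: (boolP (_ \in B)) => jB; last first.
  by rewrite big1 // => i iB; case: eqP iB jB => // -> ->.
by rewrite (bigD1 (inZp j)) //= eqxx big1 // => i /andP[_ /negPf ->].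
Qed.

Definition piece (A : {set U}) (i : Zmod n) := A :&: (g ^+ i *: H)%g.

Lemma card_pieces (A : {set U}) : #|A| = (\sum_i #|piece A i|)%N.
Proof.
rewrite -sum1_card; under eq_bigr => u _ do rewrite -(sum_mem_lcoset u).
rewrite exchange_big /=; apply: eq_bigr => i _.
rewrite -sum1_card big_mkcond [RHS]big_mkcond; apply: eq_bigr => u _.
by rewrite inE; case: (u \in A); case: (u \in _).
Qed.

Lemma card_pieces_coset_union (A : {set U}) (B : {set Zmod n}) :
  #|A :&: coset_union g H B| = (\sum_(i in B) #|piece A i|)%N.
Proof.
rewrite -sum1_card big_mkcond.
transitivity (\sum_(u in A) (u \in coset_union g H B))%N.
  rewrite [RHS]big_mkcond; apply: eq_bigr => u _.
  by rewrite inE; case: (u \in A); case: (u \in coset_union g H B).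
under eq_bigr => u _ do rewrite mem_coset_union.
rewrite exchange_big /=; apply: eq_bigr => i _.
rewrite -sum1_card big_mkcond [RHS]big_mkcond; apply: eq_bigr => u _.
by rewrite inE; case: (u \in A); case: (u \in _).
Qed.

Lemma card_coset_union (B : {set Zmod n}) : #|coset_union g H B| = (#|B| * #|H|)%N.
Proof.
rewrite -[coset_union g H B]setTI card_pieces_coset_union -sum_nat_const.
by apply: eq_bigr => i _; rewrite /piece setTI card_lcoset.
Qed.

Lemma prod_mem_lcoset k (u : 'I_k -> U) (b : 'I_k -> Zmod n) :
    (forall i, u i \in (g ^+ b i *: H)%g) ->
  (\prod_i u i)%g \in (g ^+ (\sum_i b i)%R *: H)%g.
Proof.
move=> ub; have abU : abelian [set: U] by exact/cyclic_abelian/field_unit_group_cyclic.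
have -> : (g ^+ (\sum_i b i)%R *: H = g ^+ (\sum_i (b i : nat))%N *: H)%g.
  apply: expg_lcoset.
  have : \sum_i b i = inZp (\sum_i (b i : nat))%N :> Zmod n.
    apply: (big_ind2 (fun (x : Zmod n) (y : nat) => x = inZp y)) => [|x y x' y' -> ->|i _].
    - by apply: val_inj; rewrite /= mod0n.
    - by apply: val_inj; rewrite /= modnDm.
    - by rewrite valZpK.
  move=> ->; rewrite /= -[RHS](modn_mod _ n); congr (_ %% _)%N.
  by rewrite [X in (_ %% X)%N = _]nS.
apply: (big_ind2 (fun (x : U) (y : nat) => x \in (g ^+ y *: H)%g)) => [|x y x' y' xy xy'|//].
  by rewrite mem_lcoset expg0 invg1 mulg1 group1.
by rewrite expgD; apply: lcoset_mul.
Qed.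

End Cosets.

(** * Large pieces of A give a set avoiding s *)

Section LargePieces.
Variables (k D : nat) (F : finFieldType) (h : {poly F}) (l n s : nat).
Variables (C : {unit F}) (f : {poly F}) (H : {group {unit F}}) (g : {unit F}) (A : {set {unit F}}).
Hypotheses (hk : (2 <= k)%N) (hD : (1 <= D)%N) (sh : size h = D.+1).
Hypotheses (hl : largest_exponent h l) (hE : h = val C *: f ^+ l) (nE : n = gcdn l #|F|.-1).
Hypotheses (indexH : #|[set: {unit F}] : H|%g = n) (gen_g : generator [set: {unit F}] g).
Hypotheses (CsH : C \in (g ^+ s *: H)%g) (avoid : avoids_values k A h).
Hypothesis qD : (2 * D <= #|F|)%N.
Variable m : nat.
Hypothesis mq : (4 * (D * D) * #|F| < m * m)%N.
Local Notation U := {unit F}.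

Definition large_pieces : {set Zmod n} := [set i | 2 * m + k <= #|piece H g A i|]%N.

Lemma large_pieces_avoid : inZp s \notin ksumset k large_pieces.
Proof.
apply/imsetP => -[b /ffun_onP bB sE].
have [k' kE] : exists k', k = k'.+2 by exists (k - 2)%N; lia.
pose S j : {set U} := if insub j is Some i then piece H g A (b i) else set0.
have cS j : (j < k)%N -> (2 * m + k <= #|S j|)%N.
  by move=> ltjk; rewrite /S insubT; have := bB (Ordinal ltjk); rewrite inE.
(* Positions 0 and 1 are kept for [X] and [Y]; the other k - 2 factors are frozen here. *)
have [|a [sa ua aS]] := @greedy_representatives _ (1%g : U) (fun j => S j.+2) k'.
  by move=> j ltj; apply: leq_trans (cS _ _); lia.
pose E : {set U} := [set u in a].
have cE : (#|E| <= k')%N by rewrite /E cardsE -sa card_size.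
have cSE j : (j < k)%N -> (2 * m <= #|S j :\: E|)%N.
  move=> ltjk; have := cS j ltjk; rewrite cardsD.
  have := leq_trans (subset_leq_card (subsetIr (S j) E)) cE; lia.
have [|X XS cX] := @exists_subset_card _ (S 0 :\: E) m.
  by have := cSE 0; rewrite kE => /(_ isT); lia.
have [|Y YS cY] := @exists_subset_card _ (S 1%N :\: E :\: X) m.
  have h1 : (2 * m <= #|S 1%N :\: E|)%N by apply: cSE; rewrite kE.
  have h2 : (#|(S 1%N :\: E) :&: X| <= m)%N by rewrite -cX subset_leq_card // subsetIr.
  by rewrite cardsD; lia.
pose c := (\prod_(u <- a) u)%g.
have abU : abelian [set: U] by exact/cyclic_abelian/field_unit_group_cyclic.
pose rep x y (i : 'I_k) : U := nth 1%g [:: x, y & a] i.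
have prod_rep x y : (\prod_i rep x y i)%g = (c * x * y)%g.
  have <- : (\prod_(u <- [:: x, y & a]) u)%g = (c * x * y)%g.
    rewrite !big_cons -/c mulgA (centsP abU (x * y)%g _ c) ?inE // mulgA //.
  rewrite (big_nth 1%g) /= sa -kE big_mkord; apply: eq_bigr => i _.
  by [].
have inS x y : x \in X -> y \in Y -> forall i : 'I_k, rep x y i \in S i.
  move=> xX yY i.
  have := subsetP XS x xX; have := subsetP YS y yY.
  rewrite !inE => /andP[_ /andP[_ yS]] /andP[_ xS].
  rewrite /rep; case: (i : nat) (ltn_ord i) => [|[|j]] //=.
  by rewrite kE !ltnS => /aS.
have in_piece x y i : x \in X -> y \in Y -> rep x y i \in piece H g A (b i).
  by move=> xX yY; have := inS x y xX yY i; rewrite /S valK.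
have := @no_solution_card F h f D l n C H sh hD hl hE nE indexH X Y c m cX cY.
suff [P1 P2] : (forall x y, x \in X -> y \in Y -> (c * x * y * C^-1)%g \in H) /\
    (forall x y z, x \in X -> y \in Y -> val (c * x * y)%g != h.[z]).
  by move=> /(_ P1 P2 qD); rewrite leqNgt mq.
split=> [x y xX yY|x y z xX yY].
  have : (c * x * y)%g \in (g ^+ (\sum_i b i)%R *: H)%g.
    rewrite -prod_rep; apply: (prod_mem_lcoset indexH gen_g) => i.
    by have := in_piece x y i xX yY; rewrite inE => /andP[].
  have -> : (g ^+ (\sum_i b i)%R *: H = g ^+ s *: H)%g.
    apply: (expg_lcoset indexH gen_g); rewrite -sE /= -[RHS](modn_mod _ n).
    congr (_ %% _)%N; congr (_ %% _)%N.
    by rewrite prednK // -indexH indexg_gt0.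
  move: CsH => /lcosetP[u uH ->] /lcosetP[v vH ->].
  rewrite (centsP abU (g ^+ s * v)%g _ (g ^+ s * u)^-1%g) ?inE //.
  by rewrite invMg -!mulgA mulKg groupM ?groupV.
have := avoid (a := rep x y) _ _ z.
have -> : \prod_(i < k) val (rep x y i) = val (c * x * y)%g.
  rewrite -prod_rep; elim/big_rec2: _ => // i u v _ ->.
  by rewrite FinRing.val_unitM.
apply; last by move=> i; have := in_piece x y i xX yY; rewrite inE => /andP[].
have urep : uniq [:: x, y & a].
  have := subsetP XS x xX; have := subsetP YS y yY.
  rewrite !inE => /andP[yX /andP[ya _]] /andP[xa _].
  rewrite /= inE negb_or xa ya ua !andbT; apply: contraNneq yX => <-.
  by [].
move=> i j /eqP; rewrite /rep nth_uniq // => [/eqP/val_inj //||];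
  by rewrite /= sa -kE ltn_ord.
Qed.

End LargePieces.

(** For k > 0 the empty set avoids [s], so the maximum is over a non-empty family. *)
Lemma max_avoid_attained k n (s : Zmod n) : (0 < k)%N ->
  exists2 B : {set Zmod n}, s \notin ksumset k B & #|B| = max_avoid k s.
Proof.
move=> k_gt0.
have [|B sB EB] := @eq_bigmax_cond _ [pred B : {set Zmod n} | s \notin ksumset k B]
  (fun B => #|B|); last by exists B.
apply/card_gt0P; exists set0; rewrite inE; apply/imsetP => -[b /ffun_onP/(_ (Ordinal k_gt0))].
by rewrite inE.
Qed.

(** * Cardinality of the symmetric difference *)

Section StructureEstimates.
Variables (F : finFieldType) (H : {group {unit F}}) (g : {unit F}) (n W : nat).
Variables (A : {set {unit F}}) (B : {set Zmod n}).
Hypotheses (indexH : #|[set: {unit F}] : H|%g = n) (gen_g : generator [set: {unit F}] g).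
Hypothesis small : forall i, i \notin B -> (#|piece H g A i| <= W)%N.
Local Notation U := (coset_union g H B).

Lemma card_outside_le : (#|A :\: U| <= n * W)%N.
Proof.
have n_gt0 : (0 < n)%N by rewrite -indexH indexg_gt0.
have := card_pieces indexH gen_g A; rewrite -(cardsID U A).
rewrite (card_pieces_coset_union indexH gen_g) [X in _ = X](bigID (mem B)) /= => /eqP.
rewrite eqn_add2l => /eqP ->.
apply: (@leq_trans (\sum_(i : Zmod n | i \notin B) W)); first exact: leq_sum.
rewrite sum_nat_const leq_mul2r; apply/orP; right.
by apply: leq_trans (max_card _) _; rewrite card_ord prednK.
Qed.

Lemma card_le_structure : (#|A| <= #|B| * #|H| + n * W)%N.
Proof.
rewrite -(cardsID U A) leq_add ?card_outside_le //.
by rewrite -(card_coset_union indexH gen_g) subset_leq_card // subsetIr.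
Qed.

(** The symmetric difference has 2 |A \ U| + |U| - |A| elements, so a lower bound on |A| bounds
    it. *)
Lemma card_symdiff_le : (#|symdiff A U| + #|A| <= #|B| * #|H| + 2 * (n * W))%N.
Proof.
have h1 := card_outside_le; have h2 := cardsID U A; have h3 := cardsID A U.
rewrite setIC (card_coset_union indexH gen_g) in h3.
have : (#|symdiff A U| <= #|A :\: U| + #|U :\: A|)%N.
  by rewrite /symdiff cardsU leq_subr.
rewrite -h2 -h3; move: h1; move: #|A :\: U| #|U :\: A| #|A :&: U| #|symdiff A U| (n * W)%N.
by move=> a1 a2 a3 a4 w; lia.
Qed.

End StructureEstimates.

(** Here t is sqrt q. If b < M, a missing coset costs q / n, while the estimates leave only (D c +
    K) t; as n <= D this gives t <= D (D c + K), against the last hypothesis. *)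
Lemma structure_bound (R : realFieldType) (q n M b hH cA sd W D : nat) (K t c : R) :
    0 < t -> t ^+ 2 = q%:R -> (0 < n)%N -> (n <= D)%N -> (hH * n <= q)%N ->
    0 <= K -> 0 <= c -> W%:R <= c * t -> (b <= M)%N ->
    (cA <= b * hH + n * W)%N -> (sd + cA <= b * hH + 2 * (n * W))%N ->
    M%:R / n%:R * q%:R - K * t <= cA%:R -> D%:R * (D%:R * c + K) < t ->
  b = M /\ sd%:R <= (K + 2%:R * D%:R * c) * t.
Proof.
move=> t0 tq n_gt0 nD hHq K0 c0 Wc bM cA_le sd_le lower big_t.
have n0 : 0 < n%:R :> R by rewrite ltr0n.
have nW : (n * W)%:R <= D%:R * (c * t).
  by rewrite natrM ler_pM ?ler0n ?ler_nat.
pose x := q%:R / n%:R : R.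
have Hx : hH%:R <= x by rewrite ler_pdivlMr // -natrM ler_nat.
have x0 : 0 <= x by rewrite divr_ge0 ?ler0n.
have bHx : (b * hH)%:R <= b%:R * x by rewrite natrM ler_wpM2l ?ler0n.
have lower' : M%:R * x - K * t <= cA%:R.
  by apply: le_trans lower; rewrite /x mulrA mulrAC.
have upper : cA%:R <= b%:R * x + D%:R * (c * t).
  by apply: (@le_trans _ _ (b * hH + n * W)%:R); rewrite ?ler_nat // natrD lerD.
have sd' : sd%:R + cA%:R <= b%:R * x + 2%:R * (D%:R * (c * t)).
  rewrite -natrD; apply: (@le_trans _ _ (b * hH + 2 * (n * W))%:R); first by rewrite ler_nat.
  by rewrite natrD lerD // [X in X <= _]natrM ler_wpM2l ?ler0n.
have bM' : b%:R * x <= M%:R * x by rewrite ler_wpM2r // ler_nat.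
have bE : b = M.
  apply/eqP; rewrite eqn_leq bM /= leqNgt; apply/negP => ltbM.
  have : b.+1%:R * x <= M%:R * x by rewrite ler_wpM2r // ler_nat.
  rewrite -natr1 mulrDl mul1r => bx.
  have xt : x <= (D%:R * c + K) * t by lra.
  have : t ^+ 2 <= n%:R * ((D%:R * c + K) * t).
    by rewrite tq -ler_pdivrMl // mulrC.
  have DcK : 0 <= D%:R * c + K by rewrite addr_ge0 // mulr_ge0 ?ler0n.
  have : n%:R * ((D%:R * c + K) * t) <= D%:R * ((D%:R * c + K) * t).
    by rewrite ler_wpM2r ?ler_nat // mulr_ge0 // ltW.
  rewrite expr2 => h1 h2; have := le_trans h2 h1.
  by rewrite mulrA ler_pM2r // leNgt big_t.
split=> //; lra.
Qed.

Theorem mainTheorem2 (R : realType) (k D : nat) (K : R)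
    (hk : (2 <= k)%N) (hD : (1 <= D)%N) (hK : 0 <= K) :
  exists K' : R,
  forall (F : finFieldType) (h : {poly F}) (l n s : nat)
    (C : {unit F}) (f : {poly F}) (H : {group {unit F}}) (g : {unit F})
    (A : {set {unit F}}),
  size h = D.+1 ->
  largest_exponent h l ->
  h = val C *: f ^+ l ->
  n = gcdn l #|F|.-1 ->
  #|[set: {unit F}] : H|%g = n ->
  generator [set: {unit F}] g ->
  (s < n)%N ->
  C \in (g ^+ s *: H)%g ->
  avoids_values k A h ->
  (max_avoid k (inZp s : Zmod n))%:R / n%:R * #|F|%:R
    - K * Num.sqrt #|F|%:R <= #|A|%:R ->
  exists B0 : {set Zmod n},
    [/\ #|B0| = max_avoid k (inZp s : Zmod n),
        inZp s \notin ksumset k B0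
      & #|symdiff A (coset_union g H B0)|%:R <= K' * Num.sqrt #|F|%:R].
Proof.
(* The [m] chosen below is at most 2 D t + 1, so 2 m + k <= c t. *)
pose c : R := 4%:R * D%:R + 2%:R + k%:R.
pose T : R := D%:R * (D%:R * c + K).
have c0 : 0 <= c by rewrite /c !addr_ge0 ?mulr_ge0 ?ler0n.
have T0 : 0 <= T by rewrite /T mulr_ge0 ?addr_ge0 ?mulr_ge0 ?ler0n.
(* The terms K + 2 D c come from [structure_bound]. [T] and 2 D serve the fields with t <= T or q <
   2 D, where the trivial bound q = t * t suffices for any extremal set. *)
exists (K + 2%:R * D%:R * c + T + 2%:R * D%:R).
move=> F h l n s C f H g A sh hl hE nE indexH gen_g _ CsH avoid lower.
have l_gt0 : (0 < l)%N by case: hl.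
have n_gt0 : (0 < n)%N by rewrite -indexH indexg_gt0.
have nD : (n <= D)%N.
  apply: leq_trans (exponent_le_degree sh hD hl hE).
  by rewrite nE dvdn_leq // dvdn_gcdl.
set t : R := Num.sqrt _ in lower *.
have q_gt0 : (0 < #|F|)%N by apply: ltnW (card_gt1 F).
have tt : t ^+ 2 = #|F|%:R by rewrite sqr_sqrtr ?ler0n.
have t1 : 1 <= t by rewrite -sqrtr1 ler_sqrt ?ler0n // ler1n.
have t0 : 0 < t by apply: lt_le_trans t1.
have D0 : 0 <= 2%:R * D%:R :> R by rewrite mulr_ge0 ?ler0n.
have Dc0 : 0 <= 2%:R * D%:R * c by rewrite mulr_ge0.
have [|big] := boolP ((#|F| < 2 * D)%N || (t <= T)).
  move=> small_q; have [B sB cB] := max_avoid_attained (inZp s : Zmod n) (ltnW hk).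
  exists B; split=> //; apply: (@le_trans _ _ (t * t)).
    rewrite -expr2 tt ler_nat; apply: leq_trans (max_card _) _.
    by rewrite -cardsT card_finField_unit leq_pred.
  rewrite ler_pM2r //; case/orP: small_q => [q2D|tT]; last by lra.
  have : t <= #|F|%:R by rewrite -tt expr2 ler_peMr // ltW.
  have : #|F|%:R <= 2%:R * D%:R :> R by rewrite -natrM ler_nat ltnW.
  by lra.
move: big; rewrite negb_or -leqNgt -ltNge => /andP[qD tT].
(* The least m excluded by [no_solution_card]; minimality gives m - 1 <= 2 D t. *)
have m_ex : exists m, (4 * (D * D) * #|F| < m * m)%N.
  by exists (4 * (D * D) * #|F|).+1; apply: leq_pmulr.
pose m := ex_minn m_ex.
have mq : (4 * (D * D) * #|F| < m * m)%N by rewrite /m; case: ex_minnP.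
have m_le : m%:R <= 2%:R * D%:R * t + 1.
  case E : m => [|m']; first by rewrite addr_ge0 ?mulr_ge0 ?ler0n // ltW.
  have : (m' * m' <= 4 * (D * D) * #|F|)%N.
    rewrite leqNgt; apply/negP => m'q; move: E; rewrite /m; case: ex_minnP => m0 _ /(_ m' m'q).
    by move=> + m0E; rewrite m0E ltnn.
  rewrite -natr1 lerD2r -(ler_nat R) => Hm'.
  rewrite -(@ler_pXn2r _ 2) ?nnegrE ?mulr_ge0 ?ler0n ?(ltW t0) //.
  have -> : (2%:R * D%:R * t) ^+ 2 = (4 * (D * D) * #|F|)%:R :> R.
    by rewrite exprMn tt !natrM; ring.
  by rewrite expr2 -natrM.
pose W := (2 * m + k)%N.
pose B := @large_pieces k F n H g A m.
have sB : inZp s \notin ksumset k B.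
  exact: (large_pieces_avoid hk hD sh hl hE nE indexH gen_g CsH avoid qD mq).
have bM : (#|B| <= max_avoid k (inZp s : Zmod n))%N.
  exact: (@leq_bigmax_cond _ _ (fun X : {set Zmod n} => #|X|) B sB).
have small i : i \notin B -> (#|piece H g A i| <= W)%N.
  by rewrite inE -ltnNge => /ltnW.
have hHq : (#|H| * n <= #|F|)%N.
  by rewrite -indexH Lagrange ?subsetT // card_finField_unit leq_pred.
have Wc : W%:R <= c * t.
  have kt : k%:R <= k%:R * t by rewrite ler_peMr ?ler0n.
  by rewrite /W natrD natrM /c; lra.
have [EB sd] := structure_bound t0 tt n_gt0 nD hHq hK c0 Wc bM
  (card_le_structure indexH gen_g small) (card_symdiff_le indexH gen_g small) lower tT.
exists B; split=> //; apply: le_trans sd _.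
by rewrite ler_pM2r //; lra.
Qed.
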